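(* There is an absolute constant $c>0$ such that the following holds. Let $n\to\infty$, with $s=s_n\ge1$, $k=k_n\ge1$, $m=m_n>0$, $\mu=\mu_n>0$ possibly depending on $n$, and suppose that there are non-adaptive sensing procedures with precision budget $m$ and estimators $\hat S$ such that $\lim_{n\to\infty}\max_{S\in\mathcal{C}}\mathbb{P}_S(\hat S\neq S)=0$, where $\mathcal{C}=\mathcal{C}_n$ is one of the classes below. Then, for all sufficiently large $n$: 1. ($s$-sets) $\mu \geq c \sqrt{\frac{n}{2m} \log \frac{n}{s}}$, when $s=o(n)$; 2. ($s$-intervals) $\mu \geq c \sqrt{\frac{n}{2sm} \log \frac{n}{s}}$, when $s=o(n)$; 3. (unions of $k$ disjoint $s$-intervals) $\mu \geq c \sqrt{\frac{n}{2sm} \log \frac{n}{ks}}$, when $ks=o(n)$; 4. (unions of $k$ disjoint $s$-stars) $\mu \geq c \sqrt{\frac{n}{2m} \log \frac{\sqrt{2n}}{ks}}$, when $ks=o(\sqrt n)$; 5. ($s$-submatrices) $\mu \geq c \sqrt{\frac{n}{4\sqrt{s}\,m} \log \frac{n}{s}}$, when $n_1=n_2=\sqrt n$, $s_1=s_2=\sqrt s$ and $s=o(n)$.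
   Context: Classes of subsets of $\{1,\dots,n\}$. $s$-sets: all subsets of cardinality $s$. $s$-intervals: sets $\{i,\dots,i+s-1\}$, $1\le i\le n-s+1$. Unions of $k$ disjoint $s$-intervals: unions of $k$ pairwise disjoint $s$-intervals. Stars: when $n=p(p-1)/2$, coordinates are identified with the edges of the complete graph on $p$ vertices; an $s$-star is a set of $s$ edges sharing a common vertex, and disjoint means no common edge. Submatrices: coordinates are identified with $\{1,\dots,n_1\}\times\{1,\dots,n_2\}$, $n=n_1n_2$; in item 5 the submatrices are the sets $S_1\times S_2$ with $|S_1|=s_1$, $|S_2|=s_2$ ($\sqrt n,\sqrt s$ integers). Non-adaptive sensing model. For an unknown $S\subseteq\{1,\dots,n\}$, the signal has $x_i=\mu$ if $i\in S$ and $x_i=0$ otherwise. Measurements are $Y_j=x_{A_j}+\Gamma_j^{-1/2}W_j$, $j=1,2,\dots$, with $W_j$ i.i.d. $\mathcal{N}(0,1)$, $A_j\in\{1,\dots,n\}$, $\Gamma_j>0$, where $\{A_j,\Gamma_j\}_j$ are chosen before any observation is collected (independently of the noise and of $S$), subject to the precision budget $\mathbb{E}\big(\sum_j\Gamma_j\big)\le m$. An estimator $\hat S$ is a function of $\{Y_j,A_j,\Gamma_j\}_j$. $\mathbb{P}_S$ is the probability when the support is $S$. *)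

(* Defs.v *)
From HB Require Import structures.
From mathcomp Require Import all_boot all_order all_algebra.
From mathcomp Require Import all_classical all_reals all_analysis.
Set Implicit Arguments.
Unset Strict Implicit.
Unset Printing Implicit Defensive.
Import Order.TTheory GRing.Theory Num.Theory.
Import numFieldNormedType.Exports.

Local Open Scope classical_set_scope.
Local Open Scope ring_scope.

(* Coordinates are the elements of a finite type T; the dimension n is #|T|. *)

Definition s_sets (n s : nat) : {set {set 'I_n}} :=
  [set S : {set 'I_n} | #|S| == s]%SET.

(* Coordinates are numbered from 0, so the intervals are {i, ..., i+s-1} with
   0 <= i <= n-s; for s >= 1 such an i is always an element of 'I_n. *)
Definition s_intervals (n s : nat) : {set {set 'I_n}} :=
  [set S : {set 'I_n} | [exists i : 'I_n,
     (i + s <= n)%N && (S == [set j : 'I_n | (i <= j < i + s)%N]%SET)]]%SET.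

(* The k members of the family are required to be distinct elements of B;
   when set0 \notin B this follows from pairwise disjointness. *)
Definition disjoint_unions (T : finType) (k : nat) (B : {set {set T}}) :
    {set {set T}} :=
  [set S : {set T} | [exists D : {set {set T}},
     [&& D \subset B, #|D| == k, finset.trivIset D
       & S == finset.cover D]]]%SET.

Definition edge (p : nat) := {e : {set 'I_p} | #|e| == 2%N}.

Definition s_stars (p s : nat) : {set {set edge p}} :=
  [set S : {set edge p} | (#|S| == s) &&
     [exists v : 'I_p, [forall e in S, v \in val e]]]%SET.

Definition submatrices (n1 n2 s1 s2 : nat) : {set {set 'I_n1 * 'I_n2}} :=
  [set S : {set 'I_n1 * 'I_n2} |
     [exists S1 : {set 'I_n1}, exists S2 : {set 'I_n2},
       [&& #|S1| == s1, #|S2| == s2 & S == finset.setX S1 S2]]]%SET.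

(* Events determined by the design (A_j, Gamma_j)_j. The design may be random but is a single family of random
   variables, common to all supports S. *)
Definition design_events (R : realType) (T : finType) (U : Type)
    (A : nat -> U -> T) (Gam : nat -> U -> R) : set (set U) :=
  <<s \bigcup_j (preimage_set_system setT (A j) setT
             `|` preimage_set_system setT (Gam j) measurable) >>.

Definition noise_events (R : realType) (U : Type) (W : nat -> U -> R) :
    set (set U) :=
  <<s \bigcup_j preimage_set_system setT (W j) measurable >>.

Record sensing_procedure (R : realType) (T : finType) := SensingProcedure {
  sp_disp : measure_display;
  sp_space : measurableType sp_disp;
  sp_prob : probability sp_space R;
  sp_loc : nat -> sp_space -> T;                        (* A_j *)
  sp_prec : nat -> {RV sp_prob >-> R};                  (* Gamma_j *)
  sp_noise : nat -> {RV sp_prob >-> R};                 (* W_j *)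
  sp_loc_measurable : forall j (a : T), measurable (sp_loc j @^-1` [set a]);
  sp_prec_gt0 : forall j w, 0 < sp_prec j w;
  sp_noise_normal : forall j (B : set R), measurable B ->
    sp_prob (sp_noise j @^-1` B) = normal_prob 0 1 B;
  sp_noise_indep : forall (J : seq nat) (B : nat -> set R), uniq J ->
    (forall j, measurable (B j)) ->
    sp_prob (\bigcap_(j in [set` J]) (sp_noise j @^-1` B j)) =
      (\prod_(j <- J) sp_prob (sp_noise j @^-1` B j))%E;
  sp_design_indep_noise : forall E F : set sp_space,
    design_events sp_loc (fun j => sp_prec j : sp_space -> R) E ->
    noise_events (fun j => sp_noise j : sp_space -> R) F ->
    sp_prob (E `&` F) = (sp_prob E * sp_prob F)%E
}.

Arguments sp_loc {R T} _.
Arguments sp_prec {R T} _.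
Arguments sp_noise {R T} _.

Definition expected_precision (R : realType) (T : finType)
    (D : sensing_procedure R T) : \bar R :=
  (\int[sp_prob D]_w (\sum_(0 <= j <oo) (sp_prec D j w)%:E))%E.

Definition signal (R : realType) (T : finType) (mu : R) (S : {set T}) (a : T) :
    R := if a \in S then mu else 0.

(* The j-th entry of a record of observations is the triple (Y_j, A_j, Gamma_j). *)
Definition observations (R : realType) (T : finType) := nat -> R * T * R.

Definition observe (R : realType) (T : finType) (D : sensing_procedure R T)
    (mu : R) (S : {set T}) (w : sp_space D) : observations R T :=
  fun j => (signal mu S (sp_loc D j w)
              + (Num.sqrt (sp_prec D j w))^-1 * sp_noise D j w,
            sp_loc D j w, sp_prec D j w).

(* Product sigma-algebra on sequences of triples, T being discrete. *)
Definition observation_events (R : realType) (T : finType) :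
    set (set (observations R T)) :=
  <<s \bigcup_j
       (preimage_set_system setT (fun y : observations R T => (y j).1.1) measurable
    `|` preimage_set_system setT (fun y : observations R T => (y j).1.2) setT
    `|` preimage_set_system setT (fun y : observations R T => (y j).2) measurable) >>.

Record estimator (R : realType) (T : finType) := Estimator {
  est_fun :> observations R T -> {set T};
  est_measurable : forall S : {set T}, observation_events (est_fun @^-1` [set S])
}.

Definition error_prob (R : realType) (T : finType) (D : sensing_procedure R T)
    (Shat : estimator R T) (mu : R) (S : {set T}) : \bar R :=
  sp_prob D [set w | Shat (observe mu S w) != S].

Definition max_error (R : realType) (T : finType) (D : sensing_procedure R T)
    (Shat : estimator R T) (mu : R) (C : {set {set T}}) : \bar R :=
  (\big[maxe/0]_(S in C) error_prob D Shat mu S)%E.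

Definition asymptotically_recoverable (R : realType) (T : nat -> finType)
    (C : forall t, {set {set T t}}) (m mu : nat -> R) : Prop :=
  exists (D : forall t, sensing_procedure R (T t))
         (Shat : forall t, estimator R (T t)),
    (forall t, (expected_precision (D t) <= (m t)%:E)%E) /\
    (fun t => max_error (D t) (Shat t) (mu t) (C t)) @ \oo --> 0%E.

(* Main.v *)
(* Two supports S0 and S0 u E can be told apart only through the precision b(E)
   that the design spends, on average, on E.  Fix S0 and pairwise disjoint sets
   E_1, ..., E_M of total expected precision at most B, such that all the
   S0 u E_i are in the class.  The M possible answers S0 u E_i are
   mutually exclusive, so under the support S0 one of them has probability at most 2/M
   while b(E_i) <= 2B/M.  A change of measure from S0 to S0 u E_i then bounds
   its probability under S0 u E_i by e^tau 2/M + 2 mu^2 b(E_i)/tau + e^(-tau/2);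
   as this must be at least 3/4, tau = (ln M)/2 gives mu^2 B >= c M ln M.
   For each class S0 and the E_i are chosen to be adapted to b: for stars at
   the vertex whose edges get the least precision, for submatrices along the
   block of rows that gets the least precision. *)

Require Import Defs.
From HB Require Import structures.
From mathcomp Require Import all_boot all_order all_algebra.
From mathcomp Require Import all_classical all_reals all_analysis.
From mathcomp Require Import measurable_realfun ring lra zify.
Set Implicit Arguments.
Unset Strict Implicit.
Unset Printing Implicit Defensive.
Import Order.TTheory GRing.Theory Num.Theory.
Import numFieldNormedType.Exports.

Local Open Scope classical_set_scope.
Local Open Scope ring_scope.

(** * Gaussian shifts and independence *)

(** As the design is non-adaptive, b is the same under every support; this is why it can be fixed
    before S0 and the E_i are chosen. S0 itself, which lacks one piece, lies outside the class: it
    serves as a reference where nothing is known of the estimator except that its answers exclude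
    each other. The change of measure meets two obstacles. The design is random with a budget that
    holds only on average, so the law of the likelihood ratio is not controlled; and there are
    infinitely many measurements. Hence the ratio is formed for the first N of them, and its lower
    tail is bounded by two applications of Markov's inequality: to the energy, the sum of Gamma_j (x
    - y)(A_j)^2, whose mean is at most mu^2 b(E), and to the ratio in the opposite direction.
    Neither bound involves N. Adding a single piece is enough for the rates: M is of order n for
    s-sets, n/s for intervals, p for stars and sqrt n for submatrices, so the logarithms obtained
    are at least those of the statement, up to constants. *)

Lemma lebesgue_measure_translation (R : realType) (h : R) (A : set R) :
  measurable A ->
  pushforward (@lebesgue_measure R)
    ((fun x => x + h) : _ -> measurableTypeR R) A = lebesgue_measure A.
Proof.
move=> mA.
have mh : measurable_fun setT ((fun x => x + h) : R -> measurableTypeR R).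
  exact: measurable_funD.
apply/esym; apply: (@lebesgue_measure_unique R
  (pushforward (@lebesgue_measure R)
    ((fun x => x + h) : _ -> measurableTypeR R))) => //= _ [[a b]] _ <-.
rewrite /pushforward [X in _ = _ X](_ : _ = `](a - h), (b - h)]%classic); last first.
  by apply/seteqP; split => x /=; rewrite !in_itv/= ltrBlDr lerBrDr.
rewrite !lebesgue_measure_itv/= !lte_fin ltrD2r; case: ifPn => // _.
by rewrite -!EFinB; congr EFin; ring.
Qed.

Lemma ge0_integral_translation (R : realType) (h : R) (f : R -> \bar R) :
  measurable_fun [set: R] f -> (forall x, 0 <= f x)%E ->
  (\int[@lebesgue_measure R]_x f (x + h)%R =
   \int[@lebesgue_measure R]_x f x)%E.
Proof.
move=> mf f0.
have mh : measurable_fun setT ((fun x => x + h) : R -> measurableTypeR R).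
  exact: measurable_funD.
transitivity (\int[pushforward (@lebesgue_measure R)
    ((fun x => (x + h)%R) : _ -> measurableTypeR R)]_x f x)%E.
  by rewrite ge0_integral_pushforward.
by apply: eq_measure_integral => A mA _; exact: lebesgue_measure_translation.
Qed.

Lemma ge0_integral_normal_prob (R : realType) (f : R -> \bar R) :
  measurable_fun [set: R] f -> (forall x, 0 <= f x)%E ->
  (\int[normal_prob 0 1]_x f x =
   \int[@lebesgue_measure R]_x (f x * (normal_pdf 0 1 x)%:E))%E.
Proof.
move=> mf f0.
have dom := @normal_prob_dominates R 0 1.
rewrite -(Radon_Nikodym_SigmaFinite.change_of_variables dom)//.
apply: ae_eq_integral => //.
- apply: emeasurable_funM => //.
  exact: measurable_int (Radon_Nikodym_SigmaFinite.f_integrable dom).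
- apply: emeasurable_funM => //; apply/measurable_EFinP.
  exact: measurable_normal_pdf.
- apply: ae_eqe_mul2l; apply: integral_ae_eq => //.
  + exact: Radon_Nikodym_SigmaFinite.f_integrable.
  + by apply/measurable_EFinP; exact: measurable_normal_pdf.
  + by move=> E _ mE; rewrite -Radon_Nikodym_SigmaFinite.f_integral.
Qed.

(** The Cameron-Martin formula in dimension one: the standard normal density at x times e^(-(hx +
    h^2/2)) is the density at x + h, and Lebesgue measure is translation invariant. *)
Lemma normal_prob_shift (R : realType) (h : R) (g : R -> \bar R) :
  measurable_fun [set: R] g -> (forall x, 0 <= g x)%E ->
  (\int[normal_prob 0 1]_x (g (x + h)%R * (expR (- (h * x + h ^+ 2 / 2)))%:E) =
   \int[normal_prob 0 1]_x g x)%E.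
Proof.
move=> mg g0.
have mh : measurable_fun setT ((fun x => x + h) : R -> R).
  exact: measurable_funD.
rewrite !ge0_integral_normal_prob//; last 2 first.
- apply: emeasurable_funM.
    by apply: measurableT_comp.
  apply/measurable_EFinP; apply: measurableT_comp => //.
  by apply: measurableT_comp => //; apply: measurable_funD.
- by move=> x; rewrite mule_ge0// lee_fin expR_ge0.
rewrite -[RHS](ge0_integral_translation h)//; last 2 first.
- apply: emeasurable_funM => //; apply/measurable_EFinP.
  exact: measurable_normal_pdf.
- by move=> x; rewrite mule_ge0// lee_fin normal_pdf_ge0.
apply: eq_integral => x _; rewrite -muleA -EFinM; congr (_ * _%:E)%E.
rewrite normal_pdfE ?oner_neq0// /normal_fun mulrCA -expRD.
by congr (_ * expR _); field.
Qed.

(** The identity on rectangles determines the joint law as a product measure, and Tonelli's theorem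
    applies to it. *)
Lemma ge0_integral_independent_pair d d1 d2 (U : measurableType d)
    (X1 : measurableType d1) (X2 : measurableType d2) (R : realType)
    (P : probability U R) (f : {mfun U >-> X1}) (g : {mfun U >-> X2})
    (P2 : probability X2 R) :
  (forall A B, measurable A -> measurable B ->
     P (f @^-1` A `&` g @^-1` B) = P (f @^-1` A) * P2 B)%E ->
  forall F : X1 * X2 -> \bar R, measurable_fun setT F -> (forall p, 0 <= F p)%E ->
  (\int[P]_w F (f w, g w) =
   \int[distribution P f]_a \int[P2]_b F (a, b))%E.
Proof.
move=> fg F mF F0.
have mfg : measurable_fun setT (fun w => (f w, g w)).
  by apply: measurable_fun_pair; exact: measurable_funP.
pose h : {mfun U >-> (X1 * X2)%type} :=
  HB.pack (fun w => (f w, g w)) (isMeasurableFun.Build _ _ _ _ _ mfg).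
transitivity (\int[distribution P h]_p F p)%E.
  by rewrite ge0_integral_distribution.
rewrite -fubini_tonelli1//.
apply: eq_measure_integral => A mA _; apply/esym.
exact: product_measure_unique.
Qed.

(** Both sides are finite measures in [A], a restriction and a multiple of [P]. They agree on the
    pi-system [G], hence on the sigma-algebra that it generates. *)
Lemma independent_of_generated d (U : measurableType d) (R : realType)
    (P : probability U R) (G : set (set U)) (C : set U) :
  G `<=` measurable -> setI_closed G -> G setT -> measurable C ->
  (forall A, G A -> P (A `&` C) = (P A * P C)%E) ->
  forall A, <<s G >> A -> P (A `&` C) = (P A * P C)%E.
Proof.
move=> Gm GI GT mC PG.
have PC : P C = (fine (P C))%:E by rewrite fineK// fin_num_measure.
have r0 : 0 <= fine (P C) by rewrite fine_ge0.
pose m2 := mscale (NngNum r0) P.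
have m2E A : m2 A = (P A * P C)%E by rewrite [in RHS]PC muleC.
move=> A GA; transitivity (m2 A); last exact: m2E.
apply: (@g_sigma_algebra_measure_unique _ R _ G Gm (fun=> setT) _ _
  (mrestr P mC) (mscale (NngNum r0) P)) => //.
- by rewrite bigcup_const.
- by move=> B GB; rewrite -[RHS]/(m2 B) m2E; exact: PG.
- by move=> _; rewrite -ge0_fin_numE// fin_num_measure.
Qed.

(** * Independence of one noise variable from the design and the other noise *)

Section design_noise_independence.
Context (R : realType) (T : finType) (D : sensing_procedure R T) (k : nat).

Definition other_noise_generator : set (set (sp_space D)) :=
  \bigcup_(j in [set j | j != k])
     preimage_set_system setT (sp_noise D j) measurable.

Definition complementary_generator : set (set (sp_space D)) :=
  \bigcup_j (preimage_set_system setT (sp_loc D j) setT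
             `|` preimage_set_system setT (sp_prec D j) measurable)
  `|` other_noise_generator.

Lemma measurable_noise_preimage j (B : set R) : measurable B ->
  measurable (sp_noise D j @^-1` B).
Proof. by move=> mB; rewrite -[X in measurable X]setTI; exact: measurable_funP. Qed.

Lemma measurable_loc_preimage j (B : set T) : measurable (sp_loc D j @^-1` B).
Proof.
rewrite (_ : _ @^-1` _ =
    \big[setU/set0]_(a <- enum T | a \in B) (sp_loc D j @^-1` [set a])).
  by apply: bigsetU_measurable => a _; exact: sp_loc_measurable.
rewrite -bigcup_seq_cond; apply/seteqP; split => w /=.
  by move=> Bw; exists (sp_loc D j w) => //=; rewrite mem_enum mem_set.
by move=> [a /= /andP[_ /set_mem Ba] ->].
Qed.

Lemma design_events_measurable : design_events (sp_loc D)
  (fun j => sp_prec D j : sp_space D -> R) `<=` measurable.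
Proof.
apply: smallest_sub; first exact: sigma_algebra_measurable.
move=> X [j _ [[B _ <-]|[B mB <-]]]; rewrite setTI.
  exact: measurable_loc_preimage.
by rewrite -[X in measurable X]setTI; exact: measurable_funP.
Qed.

Lemma other_noise_measurable : <<s other_noise_generator >> `<=` measurable.
Proof.
apply: smallest_sub; first exact: sigma_algebra_measurable.
by move=> X [j _ [B mB <-]]; rewrite setTI; exact: measurable_noise_preimage.
Qed.

Lemma other_noise_independent (F : set (sp_space D)) (B : set R) :
  <<s other_noise_generator >> F -> measurable B ->
  sp_prob D (F `&` sp_noise D k @^-1` B) =
  (sp_prob D F * sp_prob D (sp_noise D k @^-1` B))%E.
Proof.
move=> GF mB.
(* A pi-system of cylinders whose index lists avoid [k]: putting [k] in front of such a list gives
   an event to which the finite independence of the noise applies. *)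
pose G : set (set (sp_space D)) := [set X | exists J (C : nat -> set R),
  [/\ uniq J, k \notin J, forall j, measurable (C j) &
      X = \bigcap_(j in [set` J]) (sp_noise D j @^-1` C j)]].
apply: (@independent_of_generated _ _ _ _ G) => //.
- move=> _ [J [C [_ _ mC ->]]]; rewrite bigcap_seq.
  apply: bigsetI_measurable => j _; exact: measurable_noise_preimage.
- move=> _ _ [J [C [uJ kJ mC ->]]] [J' [C' [uJ' kJ' mC' ->]]].
  exists (undup (J ++ J')), (fun j => (if j \in J then C j else setT) `&`
    (if j \in J' then C' j else setT)); split.
  + exact: undup_uniq.
  + by rewrite mem_undup mem_cat negb_or kJ.
  + by move=> j; apply: measurableI; case: ifP.
  + apply/seteqP; split => w /=.
      move=> [H H'] j /=; rewrite mem_undup mem_cat => _.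
      by split; case: ifP => // h; [exact: H|exact: H'].
    move=> H; split => j /= jJ.
      by have := H j; rewrite /= mem_undup mem_cat jJ => -[].
    have := H j; rewrite /= mem_undup mem_cat jJ orbT => -[]//.
- exists [::], (fun=> setT); split => //.
  by apply/seteqP; split => w //= _ j.
- exact: measurable_noise_preimage.
- move=> _ [J [C [uJ kJ mC ->]]].
  have mC' j : measurable (if j == k then B else C j) by case: ifP.
  have uJ' : uniq (k :: J) by rewrite /= kJ.
  have := @sp_noise_indep _ _ D _ _ uJ' mC'; rewrite big_cons eqxx => H.
  transitivity (sp_prob D (\bigcap_(j in [set` k :: J])
      sp_noise D j @^-1` (if j == k then B else C j))).
    congr (sp_prob D _); apply/seteqP; split => w /=.
      move=> [HC HB] j /=; rewrite inE => /orP[/eqP ->|jJ]; first by rewrite eqxx.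
      by case: ifPn => [/eqP ->//|_]; exact: HC.
    move=> HC; split; last by have := HC k; rewrite /= mem_head eqxx; apply.
    move=> j /= jJ; have := HC j; rewrite /= inE jJ orbT => /(_ isT).
    by case: ifPn => // /eqP jk; move: kJ; rewrite -jk jJ.
  rewrite H muleC; congr (_ * _)%E; rewrite (@sp_noise_indep _ _ D _ _ uJ mC).
  apply: eq_big_seq => j jJ; case: ifPn => // /eqP jk.
  by move: kJ; rewrite -jk jJ.
- apply: smallest_sub GF; first exact: smallest_sigma_algebra.
  move=> X [j /= jk [C mC <-]]; apply: sub_sigma_algebra.
  exists [:: j], (fun=> C); split => //.
    by rewrite inE eq_sym.
  rewrite setTI; apply/seteqP; split => w /=.
    by move=> H i /=; rewrite inE => /eqP ->.
  by apply; rewrite /= inE.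
Qed.

(** A procedure provides independence of the design from the noise as a whole, and of the noise
    variables from each other. Both combine on the pi-system of intersections of a design event with
    an event of the other noise: split off the design, then noise [k], and reassemble the first two
    factors. *)
Lemma complementary_independent (X : set (sp_space D)) (B : set R) :
  <<s complementary_generator >> X -> measurable B ->
  sp_prob D (X `&` sp_noise D k @^-1` B) =
  (sp_prob D X * normal_prob 0 1 B)%E.
Proof.
move=> GX mB; rewrite -(sp_noise_normal D k mB).
pose DE := design_events (sp_loc D) (fun j => sp_prec D j : sp_space D -> R).
have noise_sub : <<s other_noise_generator >> `<=`
    noise_events (fun j => sp_noise D j : sp_space D -> R).
  by apply: sub_sigma_algebra2 => Y [j _ [C mC <-]]; exists j => //; exists C.
pose UG (G : set (set (sp_space D))) := g_sigma_algebraType G.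
pose G : set (set (sp_space D)) := [set X | exists E F,
  [/\ DE E, <<s other_noise_generator >> F & X = E `&` F]].
apply: (@independent_of_generated _ _ _ _ G) => //.
- move=> _ [E [F [dE nF ->]]]; apply: measurableI.
    exact: design_events_measurable.
  exact: other_noise_measurable.
- move=> _ _ [E [F [dE nF ->]]] [E' [F' [dE' nF' ->]]].
  exists (E `&` E'), (F `&` F'); split; last by rewrite setIACA.
  + exact: (@measurableI _ (UG _)).
  + exact: (@measurableI _ (UG _)).
- exists setT, setT; split; last by rewrite setIT.
  + exact: (@measurableT _ (UG _)).
  + exact: (@measurableT _ (UG _)).
- exact: measurable_noise_preimage.
- move=> _ [E [F [dE nF ->]]].
  have nFC : noise_events (fun j => sp_noise D j : sp_space D -> R)
      (F `&` sp_noise D k @^-1` B).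
    apply: (@measurableI _ (UG _)); first exact: noise_sub.
    by apply: sub_sigma_algebra; exists k => //; exists B => //; rewrite setTI.
  rewrite -setIA (@sp_design_indep_noise _ _ D _ _ dE nFC).
  rewrite (@sp_design_indep_noise _ _ D _ _ dE (noise_sub _ nF)).
  by rewrite other_noise_independent// muleA.
- apply: smallest_sub GX; first exact: smallest_sigma_algebra.
  move=> Y [YD|YN]; apply: sub_sigma_algebra.
    exists Y, setT; split; last by rewrite setIT.
    + exact: sub_sigma_algebra.
    + exact: (@measurableT _ (UG _)).
  exists setT, Y; split; last by rewrite setTI.
  + exact: (@measurableT _ (UG _)).
  + exact: sub_sigma_algebra.
Qed.

End design_noise_independence.

(** * Change of measure between two signals *)

Section observations.
Context (R : realType) (T : finType).

Definition measurable_observation d (X : measurableType d)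
    (phi : X -> observations R T) : Prop := forall j,
  [/\ measurable_fun setT (fun w => (phi w j).1.1),
      forall B : set T, measurable ((fun w => (phi w j).1.2) @^-1` B) &
      measurable_fun setT (fun w => (phi w j).2)].

(* Quantifying over all parametrizations avoids equipping [observations R T]
   with a measurableType structure, which would require a point of [T]. *)
Definition observation_measurable (f : observations R T -> \bar R) : Prop :=
  forall d (X : measurableType d) (phi : X -> observations R T),
    measurable_observation phi -> measurable_fun setT (f \o phi).

Lemma measurable_preimage_observation_events d (X : measurableType d)
    (phi : X -> observations R T) (E : set (observations R T)) :
  measurable_observation phi -> observation_events E ->
  measurable (phi @^-1` E).
Proof.
move=> mphi; move: E; suff: @observation_events R T `<=`
    [set E : set (observations R T) | measurable (phi @^-1` E)] by exact.
apply: smallest_sub.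
  split => /=; first by rewrite preimage_set0.
    by move=> E mE; rewrite setTD preimage_setC; exact: measurableC.
  by move=> E mE; rewrite preimage_bigcup; exact: bigcupT_measurable.
move=> E [j _ /= [[[B mB <-]|[B mB <-]]|[B mB <-]]]; have [m1 m2 m3] := mphi j.
- by rewrite /= setTI -[X in measurable X]setTI; exact: m1.
- by rewrite /= setTI; exact: m2.
- by rewrite /= setTI -[X in measurable X]setTI; exact: m3.
Qed.

Lemma measurable_comp_finite d (X : measurableType d) (a : X -> T) (x : T -> R) :
  (forall B : set T, measurable (a @^-1` B)) -> measurable_fun setT (x \o a).
Proof. by move=> ma _ B mB; rewrite setTI comp_preimage; exact: ma. Qed.

Definition noisy (x : T -> R) (a : T) (g u : R) : R * T * R :=
  (x a + (Num.sqrt g)^-1 * u, a, g).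

Lemma measurable_noisy d (X : measurableType d) (x : T -> R) (a : X -> T)
    (g u : X -> R) :
  (forall B : set T, measurable (a @^-1` B)) ->
  (forall w, 0 < g w) -> measurable_fun setT g -> measurable_fun setT u ->
  measurable_fun setT (fun w => (noisy x (a w) (g w) (u w)).1.1).
Proof.
move=> ma g0 mg mu.
(* [powR] with a fixed exponent is measurable in its base, so the inverse square root is written as
   a power. *)
rewrite (_ : (fun _ => _) =
    (x \o a) \+ ((fun w => g w `^ (- 2^-1)) \* u)); last first.
  apply/funext => w /=; rewrite powRN powR12_sqrt// ltW//.
apply: measurable_funD; first exact: measurable_comp_finite.
apply: measurable_funM => //.
exact: (@measurableT_comp _ _ _ _ _ _ (fun r : R => r `^ (- 2^-1))).
Qed.

(** The density of N(y a, 1/g) divided by that of N(x a, 1/g), at the observed value v. *)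
Definition likelihood_ratio (x y : T -> R) (o : R * T * R) : R :=
  let: (v, a, g) := o in
  expR (- ((x a - y a) * g * (v - x a) + (x a - y a) ^+ 2 * g / 2)).

Lemma likelihood_ratio_noisy (x y : T -> R) (a : T) (g u : R) : 0 < g ->
  likelihood_ratio x y (noisy x a g u) =
  let h := Num.sqrt g * (x a - y a) in expR (- (h * u + h ^+ 2 / 2)).
Proof.
move=> g0; have s0 : 0 < Num.sqrt g by rewrite sqrtr_gt0.
have gE : g = Num.sqrt g ^+ 2 by rewrite sqr_sqrtr ?ltW.
rewrite /likelihood_ratio/=; congr (expR (- _)).
set s := Num.sqrt g in s0 gE *; rewrite gE; field; exact: lt0r_neq0.
Qed.

Lemma noisy_shift (x y : T -> R) (a : T) (g u : R) : 0 < g ->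
  noisy x a g u = noisy y a g (u + Num.sqrt g * (x a - y a)).
Proof.
move=> g0; have s0 : 0 < Num.sqrt g by rewrite sqrtr_gt0.
by rewrite /noisy; congr (_, _, _); field; exact: lt0r_neq0.
Qed.

Lemma observation_measurable_likelihood_ratio (x y : T -> R) j :
  observation_measurable (fun o => (likelihood_ratio x y (o j))%:E).
Proof.
move=> d X phi mphi; apply/measurable_EFinP; have [m1 m2 m3] := mphi j.
rewrite (_ : (fun _ => _) = expR \o (fun w =>
    - (((x \- y) (phi w j).1.2 * (phi w j).2) *
       ((phi w j).1.1 - x (phi w j).1.2) +
       ((x \- y) (phi w j).1.2) ^+ 2 * (phi w j).2 / 2))); last first.
  by apply/funext => w /=; rewrite /likelihood_ratio; case: (phi w j) => -[].
have mz (z : T -> R) : measurable_fun setT (fun w => z (phi w j).1.2).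
  exact: (measurable_comp_finite z m2).
apply: measurableT_comp => //; apply: measurable_funN.
apply: measurable_funD.
  by apply: measurable_funM; [exact: measurable_funM|exact: measurable_funB].
apply: measurable_funM => //; apply: measurable_funM => //.
exact: measurable_funX.
Qed.

Lemma observation_measurableM (f g : observations R T -> \bar R) :
  observation_measurable f -> observation_measurable g ->
  observation_measurable (f \* g)%E.
Proof. by move=> mf mg d X phi mphi; apply: emeasurable_funM; [exact: mf|exact: mg]. Qed.

End observations.

(* [hybrid x y k] observes [y] in the measurements before [k] and [x] from [k]
   on.  Given the design and the noise of all other measurements, passing from
   [k] to [k.+1] is a shift of a single Gaussian variable. *)
Section hybrid_observations.
Context (R : realType) (T : finType) (D : sensing_procedure R T).

Definition observe_signal (x : T -> R) (w : sp_space D) : observations R T :=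
  fun j => noisy x (sp_loc D j w) (sp_prec D j w) (sp_noise D j w).

Definition hybrid (x y : T -> R) (k : nat) (w : sp_space D) : observations R T :=
  fun j => noisy (if (j < k)%N then y else x)
    (sp_loc D j w) (sp_prec D j w) (sp_noise D j w).

Lemma measurable_hybrid x y k : measurable_observation (hybrid x y k).
Proof.
move=> j; split => //=.
- apply: measurable_noisy => //.
  + by move=> B; exact: measurable_loc_preimage.
  + by move=> w; exact: sp_prec_gt0.
- by move=> B; exact: measurable_loc_preimage.
Qed.

Lemma measurable_observe_signal x : measurable_observation (observe_signal x).
Proof. exact: (measurable_hybrid x x 0). Qed.

Section one_step.
Variables (x y : T -> R) (k : nat).

Let UG := g_sigma_algebraType (@complementary_generator R T D k).

(** Noise [k] becomes an argument of its own, so that it can be integrated first. [UG] is the sample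
    space with the coarser sigma-algebra of all other data; the identity into it is the random
    variable that carries these data. *)
Let split_observation (z : T -> R) (p : UG * R) : observations R T :=
  fun j => if j == k
    then noisy z (sp_loc D k p.1) (sp_prec D k p.1) p.2
    else hybrid x y k p.1 j.

Let hybridE w : hybrid x y k w = split_observation x (w, sp_noise D k w).
Proof.
apply/funext => j; rewrite /split_observation; case: eqVneq => // ->.
by rewrite /hybrid ltnn.
Qed.

Let hybridSE w : hybrid x y k.+1 w = split_observation y (w, sp_noise D k w).
Proof.
apply/funext => j; rewrite /split_observation; case: eqVneq => [->|jk].
  by rewrite /hybrid ltnSn.
by rewrite /hybrid ltnS leq_eqVlt (negbTE jk).
Qed.

Let measurable_loc_complementary j (B : set T) :
  measurable ((sp_loc D j : UG -> T) @^-1` B).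
Proof.
apply: sub_sigma_algebra; left; exists j => //; left; exists B => //.
by rewrite setTI.
Qed.

Let measurable_prec_complementary j :
  measurable_fun [set: UG] (sp_prec D j : UG -> R).
Proof.
move=> _ B mB; apply: sub_sigma_algebra; left; exists j => //; right.
by exists B.
Qed.

Let measurable_noise_complementary j : j != k ->
  measurable_fun [set: UG] (sp_noise D j : UG -> R).
Proof.
by move=> jk _ B mB; apply: sub_sigma_algebra; right; exists j => //; exists B.
Qed.

Let measurable_split z : measurable_observation (split_observation z).
Proof.
have mfst (f : UG -> R) : measurable_fun setT f ->
    measurable_fun [set: UG * R] (fun p => f p.1).
  by move=> mf; exact: measurableT_comp mf measurable_fst.
have mloc j (B : set T) :
    measurable ((fun p : UG * R => sp_loc D j p.1) @^-1` B).
  rewrite -[X in measurable X]setTI.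
  exact: (@measurable_fst _ _ UG R measurableT _ (measurable_loc_complementary j B)).
have mprec j := mfst _ (measurable_prec_complementary j).
move=> j; rewrite /split_observation; case: eqVneq => [_|jk]; split => //=.
- apply: measurable_noisy => //; first by move=> w; exact: sp_prec_gt0.
- apply: measurable_noisy => //; first by move=> w; exact: sp_prec_gt0.
  by apply: mfst; exact: measurable_noise_complementary.
Qed.

Let measurable_to_complementary :
  measurable_fun [set: sp_space D] (idfun : sp_space D -> UG).
Proof.
move=> _ X mX; rewrite setTI preimage_id.
move: X mX; apply: smallest_sub; first exact: sigma_algebra_measurable.
move=> X [XD|XN].
  by apply: design_events_measurable; exact: sub_sigma_algebra.
by apply: (@other_noise_measurable _ _ D k); exact: sub_sigma_algebra.
Qed.

Let toUG : {mfun sp_space D >-> UG} :=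
  HB.pack (idfun : sp_space D -> UG)
    (isMeasurableFun.Build _ _ _ _ _ measurable_to_complementary).

Let law := distribution (sp_prob D) toUG.

Let measurable_noise_k :
  measurable_fun setT (sp_noise D k : sp_space D -> measurableTypeR R).
Proof. by move=> _ B mB; rewrite setTI; exact: measurable_noise_preimage. Qed.

Let noise_k : {mfun sp_space D >-> measurableTypeR R} :=
  HB.pack (sp_noise D k : sp_space D -> measurableTypeR R)
    (isMeasurableFun.Build _ _ _ _ _ measurable_noise_k).

Let integral_joint (F : UG * R -> \bar R) :
  measurable_fun setT F -> (forall p, 0 <= F p)%E ->
  (\int[sp_prob D]_w F (w, sp_noise D k w) =
   \int[law]_w \int[normal_prob 0 1]_u F (w, u))%E.
Proof.
move=> mF F0.
apply: (@ge0_integral_independent_pair _ _ _ _ _ _ _ _ toUG noise_k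
  (normal_prob 0 1 : probability (measurableTypeR R) R)) => // A B mA mB.
exact: complementary_independent.
Qed.

Lemma change_signal_step (f : observations R T -> \bar R) :
  observation_measurable f -> (forall o, 0 <= f o)%E ->
  (\int[sp_prob D]_w (f (hybrid x y k w) *
      (likelihood_ratio x y (hybrid x y k w k))%:E) =
   \int[sp_prob D]_w f (hybrid x y k.+1 w))%E.
Proof.
move=> mf f0.
pose F p := (f (split_observation x p) *
  (likelihood_ratio x y (split_observation x p k))%:E)%E.
have lr0 o : (0 <= (likelihood_ratio x y o)%:E)%E.
  by case: o => -[v a] g; rewrite lee_fin expR_ge0.
transitivity (\int[sp_prob D]_w F (w, sp_noise D k w))%E.
  by apply: eq_integral => w _; rewrite hybridE.
transitivity (\int[sp_prob D]_w f (split_observation y (w, sp_noise D k w)))%E;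
  last by apply: eq_integral => w _; rewrite hybridSE.
rewrite integral_joint; last 2 first.
- exact: (observation_measurableM mf
    (@observation_measurable_likelihood_ratio _ _ x y k) (measurable_split x)).
- by move=> p; rewrite mule_ge0.
rewrite (integral_joint (mf _ _ _ (measurable_split y))); last first.
  by move=> p; exact: f0.
apply: eq_integral => w _.
(* With the other data frozen, observing [x] with noise u is observing [y] with noise u + h for this
   h, and the likelihood ratio is the density that compensates the shift. *)
rewrite -[RHS](normal_prob_shift (Num.sqrt (sp_prec D k w) *
  (x (sp_loc D k w) - y (sp_loc D k w)))); last 2 first.
- exact: (@measurable_fun_pair2 _ _ _ _ _ _ _ (w : UG)
    (mf _ _ _ (measurable_split y))).
- by move=> u; exact: f0.
apply: eq_integral => u _; rewrite /F; congr (f _ * _)%E.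
  apply/funext => j; rewrite /split_observation; case: ifP => //= _.
  by rewrite -noisy_shift// sp_prec_gt0.
by rewrite /split_observation eqxx likelihood_ratio_noisy// sp_prec_gt0.
Qed.

End one_step.

Lemma change_signal (x y : T -> R) N (f : observations R T -> \bar R) :
  observation_measurable f -> (forall o, 0 <= f o)%E ->
  (\int[sp_prob D]_w (f (observe_signal x w) *
      (\prod_(j < N) likelihood_ratio x y (observe_signal x w j))%:E) =
   \int[sp_prob D]_w f (hybrid x y N w))%E.
Proof.
elim: N f => [|N IH] f mf f0.
  by apply: eq_integral => w _; rewrite big_ord0 mule1.
rewrite -change_signal_step//.
(* The ratio at [N] is absorbed into the test function; this is sound because [hybrid x y N] still
   observes [x] at measurement [N]. *)
rewrite -(IH (fun o => f o * (likelihood_ratio x y (o N))%:E)%E); last 2 first.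
- exact: (observation_measurableM mf
    (@observation_measurable_likelihood_ratio _ _ x y N)).
- move=> o; rewrite mule_ge0//; case: (o N) => -[v a] g.
  by rewrite lee_fin expR_ge0.
apply: eq_integral => w _; rewrite big_ord_recr/= -muleA -EFinM.
by rewrite [X in (_ * X%:E)%E]mulrC.
Qed.

End hybrid_observations.

Arguments likelihood_ratio : simpl never.

(** * Likelihood ratios, energy and the precision spent on each coordinate *)

Section two_signals.
Context (R : realType) (T : finType) (D : sensing_procedure R T).

(** The weight b on single coordinates. It involves the design alone and therefore no support. *)
Definition location_precision (a : T) : \bar R :=
  (\int[sp_prob D]_w
     (\sum_(0 <= j <oo) (sp_prec D j w * (sp_loc D j w == a)%:R)%:E))%E.

Lemma markov_ge0 (f : sp_space D -> R) (c v : R) :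
  measurable_fun setT f -> (forall w, 0 <= f w) -> 0 < c ->
  (\int[sp_prob D]_w (f w)%:E <= v%:E)%E ->
  (sp_prob D [set w | (c <= f w)%R] <= (v / c)%:E)%E.
Proof.
move=> mf f0 c0 fv.
have mEf : measurable_fun setT (EFin \o f) by exact/measurable_EFinP.
have := @le_integral_abse _ _ _ (sp_prob D) _ measurableT _ c mEf c0.
rewrite (_ : [set: _] `&` _ = [set w | (c <= f w)%R]); last first.
  by apply/seteqP; split => w /=; rewrite lee_fin ger0_norm//; case.
rewrite (_ : (\int[_]_w _)%E = (\int[sp_prob D]_w (f w)%:E)%E); last first.
  by apply: eq_integral => w _; rewrite gee0_abs// lee_fin.
move=> /le_trans/(_ fv).
by rewrite EFinM lee_pdivlMr// muleC.
Qed.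

Lemma measurable_likelihood_ratio (x y z : T -> R) N :
  measurable_fun setT (fun w : sp_space D =>
    \prod_(j < N) likelihood_ratio x y (observe_signal z w j)).
Proof.
apply: measurable_prod => j _; apply/measurable_EFinP.
exact: (@observation_measurable_likelihood_ratio R T x y j _ _ _
  (measurable_observe_signal D z)).
Qed.

Lemma likelihood_ratio_ge0 (x y : T -> R) o : 0 <= likelihood_ratio x y o.
Proof. by case: o => -[v a] g; rewrite expR_ge0. Qed.

(** Given the design, twice the Kullback-Leibler divergence between the first [N] observations of
    [x] and of [y]. *)
Definition signal_energy (x y : T -> R) N (w : sp_space D) : R :=
  \sum_(j < N) sp_prec D j w * (x (sp_loc D j w) - y (sp_loc D j w)) ^+ 2.

(** Both products are evaluated at the same noise u: the exponents -(hu + h^2/2) and hu - h^2/2 add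
    up to -h^2, which depends on the design only. *)
Lemma likelihood_ratio_swap (x y : T -> R) N (w : sp_space D) :
  (\prod_(j < N) likelihood_ratio x y (observe_signal x w j)) *
  (\prod_(j < N) likelihood_ratio y x (observe_signal y w j)) =
  expR (- signal_energy x y N w).
Proof.
rewrite -big_split/= /signal_energy -sumrN expR_sum.
apply: eq_bigr => j _; rewrite /observe_signal !likelihood_ratio_noisy ?sp_prec_gt0//=.
rewrite -expRD; congr expR.
have := sp_prec_gt0 j w; set g := sp_prec D j w => g0.
have : g = Num.sqrt g ^+ 2 by rewrite sqr_sqrtr ?ltW.
by set r := Num.sqrt g => ->; field.
Qed.

Lemma measurable_located_precision j (a : T) :
  measurable_fun setT
    (fun w => (sp_prec D j w * (sp_loc D j w == a)%:R)%:E).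
Proof.
apply/measurable_EFinP; apply: measurable_funM => //.
apply: (@measurable_comp_finite R T _ _ (sp_loc D j) (fun b => (b == a)%:R)).
exact: measurable_loc_preimage.
Qed.

Lemma located_precision_ge0 j (a : T) w :
  (0 <= (sp_prec D j w * (sp_loc D j w == a)%:R)%:E)%E.
Proof. by rewrite lee_fin mulr_ge0// ltW// sp_prec_gt0. Qed.

Lemma measurable_located_precision_series (a : T) :
  measurable_fun setT (fun w =>
    (\sum_(0 <= j <oo) (sp_prec D j w * (sp_loc D j w == a)%:R)%:E)%E).
Proof.
apply: ge0_emeasurable_sum => [j w _ _|j _]; first exact: located_precision_ge0.
exact: measurable_located_precision.
Qed.

Lemma located_precision_series_ge0 (a : T) w :
  (0 <= \sum_(0 <= j <oo) (sp_prec D j w * (sp_loc D j w == a)%:R)%:E)%E.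
Proof. by apply: nneseries_ge0 => j _ _; exact: located_precision_ge0. Qed.

Lemma location_precision_sum :
  (\sum_a location_precision a <= expected_precision D)%E.
Proof.
rewrite -ge0_integral_sum//=; last 2 first.
- by move=> a; exact: measurable_located_precision_series.
- by move=> a w _; exact: located_precision_series_ge0.
rewrite le_eqVlt; apply/orP; left; apply/eqP.
apply: eq_integral => w _; rewrite -nneseries_sum; last first.
  by move=> a j _; exact: located_precision_ge0.
apply: eq_eseriesr => j _; rewrite sumEFin -mulr_sumr; congr EFin.
rewrite (bigD1 (sp_loc D j w))//= eqxx big1 ?addr0 ?mulr1// => a.
by rewrite eq_sym => /negbTE ->.
Qed.

Lemma location_precision_ge0 a : (0 <= location_precision a)%E.
Proof. by apply: integral_ge0 => w _; exact: located_precision_series_ge0. Qed.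

Lemma location_precision_fin_num a m : (expected_precision D <= m%:E)%E ->
  location_precision a \is a fin_num.
Proof.
move=> Dm; rewrite ge0_fin_numE ?location_precision_ge0//.
apply: le_lt_trans (ltry m); apply: le_trans Dm.
apply: le_trans location_precision_sum.
rewrite (bigD1 a)//= leeDl// sume_ge0// => b _; exact: location_precision_ge0.
Qed.

Lemma signal_energyE x y N w : signal_energy x y N w =
  \sum_a (x a - y a) ^+ 2 *
    \sum_(j < N) sp_prec D j w * (sp_loc D j w == a)%:R.
Proof.
under eq_bigr do rewrite mulr_sumr.
rewrite exchange_big; apply: eq_bigr => j _ /=.
rewrite (bigD1 (sp_loc D j w))//= eqxx big1 ?addr0 ?mulr1 1?mulrC// => a.
by rewrite eq_sym => /negbTE ->; rewrite !mulr0.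
Qed.

Lemma measurable_signal_energy x y N :
  measurable_fun setT (signal_energy x y N).
Proof.
apply: measurable_sum => j; apply: measurable_funM => //.
apply: (@measurable_comp_finite R T _ _ (sp_loc D j)
  (fun a => (x a - y a) ^+ 2)).
exact: measurable_loc_preimage.
Qed.

Lemma integral_signal_energy_le x y N m : (expected_precision D <= m%:E)%E ->
  (\int[sp_prob D]_w (signal_energy x y N w)%:E <=
   (\sum_a (x a - y a) ^+ 2 * fine (location_precision a))%:E)%E.
Proof.
move=> Dm; pose g (a : T) w : \bar R := (\sum_(0 <= j <oo)
  (sp_prec D j w * (sp_loc D j w == a)%:R)%:E)%E.
have g0 a w : (0 <= g a w)%E by exact: located_precision_series_ge0.
have mg a : measurable_fun setT (g a).
  exact: measurable_located_precision_series.
apply: (@le_trans _ _ (\int[sp_prob D]_w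
    (\sum_a ((x a - y a) ^+ 2)%:E * g a w))%E).
  apply: ge0_le_integral => //.
  - move=> w _; rewrite lee_fin sumr_ge0// => j _.
    by rewrite mulr_ge0 ?sqr_ge0// ltW// sp_prec_gt0.
  - by apply/measurable_EFinP; exact: measurable_signal_energy.
  - by apply: emeasurable_sum => a; exact: measurable_funeM.
  - move=> w _; rewrite signal_energyE -sumEFin.
    apply: lee_sum => a _; rewrite EFinM lee_wpmul2l// ?lee_fin ?sqr_ge0//.
    rewrite -sumEFin -(big_mkord xpredT
      (fun j => (sp_prec D j w * (sp_loc D j w == a)%:R)%:E)).
    by apply: nneseries_lim_ge => j _ _; exact: located_precision_ge0.
rewrite ge0_integral_sum//; last 2 first.
- by move=> a; exact: measurable_funeM.
- by move=> a w _; rewrite mule_ge0// lee_fin sqr_ge0.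
rewrite -sumEFin; apply: lee_sum => a _.
rewrite ge0_integralZl_EFin ?sqr_ge0//.
rewrite [leRHS]EFinM fineK//.
exact: location_precision_fin_num Dm.
Qed.

End two_signals.

(** * Comparison of the probabilities of an event under two signals *)

Section change_of_measure.
Context (R : realType) (T : finType) (D : sensing_procedure R T).
Variables (x y : T -> R) (m tau : R).
Hypotheses (Dm : (expected_precision D <= m%:E)%E) (tau_gt0 : 0 < tau).

Let P := sp_prob D.

Let V := \sum_a (x a - y a) ^+ 2 * fine (location_precision D a).

(* The likelihood ratios in the two directions multiply to exp(-energy): if one
   is small, then either the energy is large or the other one, whose mean is 1,
   is large. *)
Lemma prob_small_likelihood_ratio N :
  (P [set w | (\prod_(j < N) likelihood_ratio x y (observe_signal x w j)
                 < expR (- tau))%R] <=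
   (2 * V / tau + expR (- (tau / 2)))%:E)%E.
Proof.
have tau2 : 0 < tau / 2 by rewrite divr_gt0.
pose L w := \prod_(j < N) likelihood_ratio x y (@observe_signal _ _ D x w j).
pose L' w := \prod_(j < N) likelihood_ratio y x (@observe_signal _ _ D y w j).
pose S1 := [set w : sp_space D | tau / 2 <= signal_energy x y N w].
pose S2 := [set w | expR (tau / 2) <= L' w].
have mH : measurable_fun setT (@signal_energy _ _ D x y N).
  exact: measurable_signal_energy.
have mL' : measurable_fun setT L' by exact: measurable_likelihood_ratio.
have mge (f : sp_space D -> R) c : measurable_fun setT f ->
    measurable [set w | c <= f w].
  move=> mf; rewrite (_ : [set w | _] = setT `&` f @^-1` `[c, +oo[).
    exact: mf.
  by rewrite setTI; apply/seteqP; split => w /=; rewrite in_itv/= andbT.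
have L0 w : 0 <= L w by apply: prodr_ge0 => j _; exact: likelihood_ratio_ge0.
have L'0 w : 0 <= L' w by apply: prodr_ge0 => j _; exact: likelihood_ratio_ge0.
have PS1 : (P S1 <= (2 * V / tau)%:E)%E.
  rewrite (_ : 2 * V / tau = V / (tau / 2)); last by field; exact: lt0r_neq0.
  apply: markov_ge0 => //.
    move=> w; apply: sumr_ge0 => j _; rewrite mulr_ge0 ?sqr_ge0// ltW//.
    exact: sp_prec_gt0.
  exact: integral_signal_energy_le Dm.
have PS2 : (P S2 <= (expR (- (tau / 2)))%:E)%E.
  rewrite expRN -div1r; apply: markov_ge0 => //; first exact: expR_gt0.
  have := @change_signal _ _ D y x N (cst 1%E).
  move=> /(_ (fun _ _ _ _ => measurable_cst _) (fun=> lee01)).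
  under eq_integral do rewrite mul1e.
  by move=> ->; rewrite integral_cst// mul1e; exact: probability_le1.
rewrite EFinD; apply: le_trans (leeD PS1 PS2).
apply: le_trans (measureU2 _ (mge _ _ mH) (mge _ _ mL')).
apply: le_measure; rewrite ?inE.
- rewrite (_ : [set w | _] = ~` [set w | expR (- tau) <= L w]).
    by apply: measurableC; apply: mge; exact: measurable_likelihood_ratio.
  by apply/seteqP; split => w /=; [move=> Lw; apply/negP|move=> /negP];
    rewrite -ltNge.
- by apply: measurableU; exact: mge.
move=> w /= Lw; have [|Hw] := leP (tau / 2) (signal_energy x y N w); first by left.
right; rewrite leNgt; apply/negP => L'w.
have := likelihood_ratio_swap x y N w; rewrite -/(L w) -/(L' w) => LL'.
have : L w * L' w <= expR (- tau) * expR (tau / 2).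
  by apply: ler_pM => //; exact: ltW.
rewrite LL' -expRD ler_expR lerNl => /le_lt_trans/(_ Hw).
by rewrite ltNge; apply/negP; rewrite negbK; lra.
Qed.

(** Where the ratio is at least e^(-tau), the indicator of the event is at most e^tau times the
    ratio, and the ratio integrates over the event to its probability under [y]. The rest is the
    event of a small ratio. An event determined by the first [N] measurements does not distinguish
    [hybrid x y N] from observations of [y]. *)
Lemma change_of_measure_cylinder N (E : set (observations R T)) :
  observation_events E ->
  (forall o o', (forall j, (j < N)%N -> o j = o' j) -> E o -> E o') ->
  (P (observe_signal x @^-1` E) <=
   (expR tau)%:E * P (observe_signal y @^-1` E)
   + (2 * V / tau + expR (- (tau / 2)))%:E)%E.
Proof.
move=> obsE EN.
pose L w := \prod_(j < N) likelihood_ratio x y (@observe_signal _ _ D x w j).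
pose B := [set w | expR (- tau) <= L w].
have mL : measurable_fun setT L by exact: measurable_likelihood_ratio.
have mB : measurable B.
  rewrite (_ : B = setT `&` L @^-1` `[expR (- tau), +oo[); first exact: mL.
  by rewrite setTI; apply/seteqP; split => w /=; rewrite in_itv/= andbT.
have mE z : measurable (@observe_signal _ _ D z @^-1` E).
  apply: measurable_preimage_observation_events obsE.
  exact: measurable_observe_signal.
set A := observe_signal x @^-1` E; have mA : measurable A by exact: mE.
have L0 w : 0 <= L w by apply: prodr_ge0 => j _; exact: likelihood_ratio_ge0.
have PAB : (P (A `&` B) <= (expR tau)%:E * P (observe_signal y @^-1` E))%E.
  have mf : observation_measurable (fun o => (\1_E o : R)%:E).
    move=> d X phi mphi; apply/measurable_EFinP.
    rewrite (_ : (fun _ => _) = \1_(phi @^-1` E)); last first.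
      by apply/funext => w; rewrite !indicE.
    apply: measurable_indic.
    exact: measurable_preimage_observation_events mphi obsE.
  have f0 o : (0 <= (\1_E o : R)%:E)%E by rewrite lee_fin.
  rewrite (_ : observe_signal y @^-1` E = hybrid x y N @^-1` E); last first.
    apply/seteqP; split => w /=; apply: EN => j jN;
      by rewrite /hybrid /observe_signal jN.
  have mh : measurable (@hybrid _ _ D x y N @^-1` E).
    apply: measurable_preimage_observation_events obsE.
    exact: measurable_hybrid.
  have indP (X : set (sp_space D)) : measurable X ->
      (P X = \int[P]_w (\1_X w : R)%:E)%E.
    by move=> mX; rewrite integral_indic// setIT.
  rewrite (indP _ mh) (indP _ (measurableI _ _ mA mB)).
  rewrite (_ : (\int[P]_w (\1_(hybrid x y N @^-1` E) w : R)%:E)%E =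
      (\int[P]_w (\1_E (hybrid x y N w) : R)%:E)%E); last first.
    by apply: eq_integral => w _; rewrite !indicE.
  rewrite -(change_signal D x y N mf f0).
  have mfL : measurable_fun setT (fun w : sp_space D =>
      ((\1_E (observe_signal x w) : R)%:E * (L w)%:E)%E).
    apply: emeasurable_funM; last exact/measurable_EFinP.
    exact: (mf _ _ _ (measurable_observe_signal D x)).
  rewrite -ge0_integralZl_EFin ?expR_ge0//; last first.
    by move=> w _; rewrite mule_ge0// lee_fin; exact: L0.
  apply: ge0_le_integral => //.
  - by apply/measurable_EFinP; apply: measurable_indic; exact: measurableI.
  - exact: measurable_funeM.
  move=> w _; rewrite -!EFinM lee_fin indicE in_setI.
  rewrite (_ : (w \in A) = (observe_signal x w \in E)) // indicE.
  case: (_ \in E) => /=; last by rewrite mul0r mulr0.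
  rewrite mul1r; case: (boolP (w \in B)) => [/set_mem Bw|_].
    by rewrite -[leLHS](expRxMexpNx_1 tau) ler_wpM2l ?expR_ge0.
  exact: (mulr_ge0 (expR_ge0 _) (L0 w)).
have -> : A = (A `&` B) `|` (A `&` ~` B) by rewrite -setIUr setUCr setIT.
have mAnB : measurable (A `&` ~` B) by apply: measurableI => //; exact: measurableC.
apply: le_trans (measureU2 _ (measurableI _ _ mA mB) mAnB) _.
apply: leeD => //; apply: le_trans (prob_small_likelihood_ratio N).
apply: le_measure; rewrite ?inE//.
  rewrite (_ : [set w | _] = ~` B); first exact: measurableC.
  by apply/seteqP; split => w /=; [move=> Lw; apply/negP|move=> /negP];
    rewrite -ltNge.
by move=> w [_ /= /negP]; rewrite -ltNge.
Qed.

(* The bound for cylinders does not depend on the number of measurements, and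
   it survives monotone limits of events. *)
Lemma change_of_measure (E : set (observations R T)) :
  observation_events E ->
  (P (observe_signal x @^-1` E) <=
   (expR tau)%:E * P (observe_signal y @^-1` E)
   + (2 * V / tau + expR (- (tau / 2)))%:E)%E.
Proof.
move=> obsE.
pose cylinders : set (set (observations R T)) := [set F | observation_events F /\
  exists N, forall o o', (forall j, (j < N)%N -> o j = o' j) -> F o -> F o'].
pose good : set (set (observations R T)) := [set F | observation_events F /\
  (P (observe_signal x @^-1` F) <=
   (expR tau)%:E * P (observe_signal y @^-1` F)
   + (2 * V / tau + expR (- (tau / 2)))%:E)%E].
have [obs0 obsC obsU] : sigma_algebra setT (@observation_events R T).
  exact: smallest_sigma_algebra.
have obsT : @observation_events R T setT by rewrite -(setD0 setT); exact: obsC.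
have obs_setC (F : set (observations R T)) :
    observation_events F -> observation_events (~` F).
  by move=> oF; have := obsC _ oF; rewrite setTD.
have obsU2 (F G : set (observations R T)) :
    observation_events F -> observation_events G ->
    observation_events (F `|` G).
  by move=> oF oG; rewrite -bigcup2E; apply: obsU => -[|[|n]].
have mpre z (F : set (observations R T)) : observation_events F ->
    measurable (@observe_signal _ _ D z @^-1` F).
  move=> oF; apply: measurable_preimage_observation_events oF.
  exact: measurable_observe_signal.
have cyl_ring : setring cylinders.
  split.
  - by split=> //; exists 0%N.
  - move=> F G [oF [N FN]] [oG [N' GN]]; split; first exact: obsU2.
    exists (maxn N N') => o o' oo' [Fo|Go]; [left; apply: FN Fo|right; apply: GN Go].
      by move=> j jN; apply: oo'; rewrite leq_max jN.
    by move=> j jN; apply: oo'; rewrite leq_max jN orbT.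
  - move=> F G [oF [N FN]] [oG [N' GN]]; split.
      rewrite setDE -[F]setCK -setCU; apply: (obs_setC).
      by apply: obsU2; [exact: obs_setC|exact: oG].
    exists (maxn N N') => o o' oo' [Fo Go]; split.
      by apply: FN Fo => j jN; apply: oo'; rewrite leq_max jN.
    move=> Go'; apply: Go; apply: GN Go' => j jN; apply/esym; apply: oo'.
    by rewrite leq_max jN orbT.
(* For increasing events the left side converges and every right side is below its value at the
   limit; for decreasing events the roles are exchanged. *)
have good_monotone : monotone good.
  split => F mF gF.
    split; first by apply: obsU => n; have [] := gF n.
    rewrite preimage_bigcup.
    have mFx n : measurable (@observe_signal _ _ D x @^-1` F n).
      by apply: mpre; have [] := gF n.
    have mFy n : measurable (@observe_signal _ _ D y @^-1` F n).
      by apply: mpre; have [] := gF n.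
    have ndx : nondecreasing_seq (fun n => @observe_signal _ _ D x @^-1` F n).
      by move=> i j ij; apply/subsetPset => w; apply: (subsetPset _ _ (mF _ _ ij)).
    apply: (cvge_to_le (nondecreasing_cvg_mu mFx (bigcupT_measurable _ mFx) ndx)).
    apply: nearW => n /=; have [_] := gF n; move=> /le_trans; apply.
    rewrite leeD2r// lee_wpmul2l ?lee_fin ?expR_ge0//.
    apply: le_measure; rewrite ?inE//.
      by apply: mpre; apply: obsU => k; have [] := gF k.
    by move=> w Fw; exists n.
  have oI : observation_events (\bigcap_n F n).
    rewrite -[X in observation_events X]setCK setC_bigcap; apply: (obs_setC).
    by apply: obsU => n; apply: (obs_setC); have [] := gF n.
  split=> //.
  have mFx n : measurable (@observe_signal _ _ D x @^-1` F n).
    by apply: mpre; have [] := gF n.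
  have mFy n : measurable (@observe_signal _ _ D y @^-1` F n).
    by apply: mpre; have [] := gF n.
  have niy : nonincreasing_seq (fun n => @observe_signal _ _ D y @^-1` F n).
    by move=> i j ij; apply/subsetPset => w; apply: (subsetPset _ _ (mF _ _ ij)).
  have cy : P \o (fun n => @observe_signal _ _ D y @^-1` F n) @ \oo -->
      P (observe_signal y @^-1` (\bigcap_n F n)).
    rewrite preimage_bigcap; apply: nonincreasing_cvg_mu => //.
      by rewrite -ge0_fin_numE// fin_num_measure.
    by rewrite -preimage_bigcap; exact: mpre.
  have cy' : ((fun n => (expR tau)%:E * P (@observe_signal _ _ D y @^-1` F n)
        + (2 * V / tau + expR (- (tau / 2)))%:E) @ \oo -->
      (expR tau)%:E * P (observe_signal y @^-1` (\bigcap_n F n))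
        + (2 * V / tau + expR (- (tau / 2)))%:E)%E.
    by apply: cvgeD; [exact: fin_num_adde_defl|exact: cvgeZl|exact: cvg_cst].
  apply: (cvge_to_ge cy'); apply: nearW => n /=.
  have [_] := gF n; apply: le_trans.
  apply: le_measure; rewrite ?inE//; first exact: mpre.
  by move=> w Fw; exact: Fw.
have cyl_good : cylinders `<=` good.
  by move=> F [oF [N FN]]; split => //; exact: change_of_measure_cylinder FN.
have cyl_sub := monotone_setring_sub_g_sigma_ring good_monotone cyl_ring cyl_good.
suff /cyl_sub[] : <<sr cylinders >> E by [].
move: E obsE; apply: smallest_sub.
  (* [setT] is a cylinder, with [N = 0], so the generated sigma-ring contains complements and is a
     sigma-algebra. *)
  have [sr0 srD srU] := smallest_sigma_ring cylinders.
  split => // F srF; apply: srD => //; apply: sub_gen_smallest.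
  by split => //; exists 0%N.
move=> F [j _ Fj]; apply: sub_gen_smallest; split.
  by apply: sub_sigma_algebra; exists j.
exists j.+1 => o o' oo'; have oj := oo' j (ltnSn j).
by case: Fj => [[[B _ <-]|[B _ <-]]|[B _ <-]] [_ /=]; rewrite oj.
Qed.

End change_of_measure.

(** * From reliable recovery to a bound over families of supports *)

Lemma sum_prob_trivIset_le1 d (U : measurableType d) (R : realType)
    (P : probability U R) (I : finType) (F : I -> set U) :
  (forall i, measurable (F i)) -> trivIset setT F ->
  (\sum_i P (F i) <= 1)%E.
Proof.
move=> mF tF.
rewrite -big_enum/= fsbig_seq ?enum_uniq//.
rewrite -measure_fin_bigcup//; last exact: sub_trivIset tF.
by apply: probability_le1; apply: fin_bigcup_measurable.
Qed.

Lemma exists_le_average (R : realType) (I : finType) (f : I -> R) (B : R) :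
  (0 < #|I|)%N -> \sum_i f i <= B -> exists i, f i <= B / #|I|%:R.
Proof.
move=> I0 fB; have M0 : 0 < #|I|%:R :> R by rewrite ltr0n.
apply: contrapT => H.
have : \sum_(i : I) (B / #|I|%:R) < \sum_i f i.
  apply: ltr_sum => [|i _]; last first.
    by rewrite ltNge; apply/negP => Hi; apply: H; exists i.
  by apply/hasP; move/card_gt0P: I0 => [i _]; exists i => //; rewrite mem_index_enum.
rewrite sumr_const -[X in X < _]mulr_natr divfK ?gt_eqF//.
by rewrite ltNge fB.
Qed.

(** The sum of [p i + q i / B] is at most 2, and an index where this quantity is at most its average
    serves for [p] and [q] at once. *)
Lemma exists_le_averages (R : realType) (I : finType) (p q : I -> R) (B : R) :
  (0 < #|I|)%N -> 0 < B -> (forall i, 0 <= p i) -> (forall i, 0 <= q i) ->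
  \sum_i p i <= 1 -> \sum_i q i <= B ->
  exists i, p i <= 2 / #|I|%:R /\ q i <= 2 * B / #|I|%:R.
Proof.
move=> I0 B0 p0 q0 p1 qB.
have pq2 : \sum_i (p i + q i / B) <= 2.
  rewrite big_split/= -mulr_suml -[leRHS]/(1 + 1); apply: lerD => //.
  by rewrite ler_pdivrMr// mul1r.
have [i Hi] := exists_le_average I0 pq2.
have qi0 : 0 <= q i / B by rewrite divr_ge0// ltW.
exists i; split; first by apply: le_trans Hi; rewrite lerDl.
have : q i / B <= 2 / #|I|%:R by apply: le_trans Hi; rewrite lerDr.
by rewrite ler_pdivrMr// mulrAC.
Qed.

(* With tau = ln M / 2, the lower bound 256 = 4 ^ 4 on M makes
   2 e^(-tau) + e^(-tau/2) at most 3/8. *)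
Lemma two_point_numeric (R : realType) (M w p V : R) :
  256 <= M -> p <= 2 / M -> 
  V <= w / M ->
  3 / 4 <= expR (ln M / 2) * p + (2 * V / (ln M / 2) + expR (- (ln M / 2 / 2))) ->
  M * ln M / 32 <= w / 2.
Proof.
move=> M256 pM VM.
have M0 : 0 < M by lra.
have lnM0 : 0 < ln M by rewrite ln_gt0//; lra.
(* Here z = e^(-tau/2) = M^(-1/4). The first and last terms of the hypothesis become at most 2 z^2
   <= 1/8 and z <= 1/4, so at least 3/8 is left to the middle one, which is at most 4 w / (M ln
   M). *)
set z := expR (- (ln M / 2 / 2)).
have z0 : 0 < z by exact: expR_gt0.
have z2 : expR (- (ln M / 2)) = z ^+ 2.
  by rewrite /z expr2 -expRD; congr expR; field.
have z4 : M^-1 = z ^+ 4.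
  rewrite (exprM z 2 2) -z2 expr2 -expRD -[in LHS](lnK M0) -expRN; congr expR.
  by field.
have z14 : z <= 1 / 4.
  rewrite leNgt; apply/negP => z14.
  have : (1 / 4) ^+ 4 < z ^+ 4 by rewrite ltrXn2r//; lra.
  by rewrite -z4 -[ltRHS]mul1r ltr_pdivlMr//; lra.
have : expR (ln M / 2) * p <= 2 * z ^+ 2.
  apply: le_trans (_ : expR (ln M / 2) * (2 / M) <= _).
    by rewrite ler_wpM2l// expR_ge0.
  rewrite -{2}(lnK M0) -z2 mulrCA -expRN -expRD ler_wpM2l//.
  by rewrite ler_expR; lra.
have : 2 * V / (ln M / 2) <= 4 * w / (M * ln M).
  rewrite (_ : 4 * w / (M * ln M) = 2 * (w / M) / (ln M / 2)); last first.
    by field; rewrite !gt_eqF.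
  by rewrite ler_pM2r ?ler_pM2l// invr_gt0 divr_gt0.
have zz : z ^+ 2 <= 1 / 16.
  have : z ^+ 2 <= (1 / 4) ^+ 2 by rewrite lerXn2r// ?nnegrE; lra.
  by lra.
move=> H1 H2 H3.
have : 3 / 8 <= 4 * w / (M * ln M) by lra.
have MlnM : 0 < M * ln M by exact: mulr_gt0.
by rewrite ler_pdivlMr//; lra.
Qed.

Section recovery.
Context (R : realType) (T : finType).

Lemma signal_sqr_diff_le (mu : R) (S0 E : {set T}) (b : T -> R) :
  (forall a, 0 <= b a) ->
  \sum_a (signal mu (S0 :|: E)%SET a - signal mu S0 a) ^+ 2 * b a <=
  mu ^+ 2 * \sum_(a in E) b a.
Proof.
move=> b0; rewrite mulr_sumr [leRHS]big_mkcond/=; apply: ler_sum => a _.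
rewrite /signal inE; case: (boolP (a \in S0)) => aS; case: (boolP (a \in E)) => aE /=.
- by rewrite subrr expr0n/= mul0r mulr_ge0// sqr_ge0.
- by rewrite subrr expr0n/= mul0r.
- by rewrite subr0.
- by rewrite subrr expr0n/= mul0r.
Qed.

(** All that the combinatorial part retains from the probabilistic one. The weights [b] are
    quantified before the families, so [S0] and [E] may be chosen according to them. *)
Definition family_lower_bound (C : {set {set T}}) (m mu : R) : Prop :=
  exists b : T -> R, [/\ forall a, 0 <= b a, \sum_a b a <= m &
    forall (I : finType) (S0 : {set T}) (E : I -> {set T}) (B : R),
      0 < B -> (256 <= #|I|)%N -> (forall i, S0 :|: E i \in C)%SET ->
      injective (fun i => S0 :|: E i)%SET ->
      \sum_i \sum_(a in E i) b a <= B ->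
      #|I|%:R * ln #|I|%:R / 32 <= mu ^+ 2 * B].

Lemma recovery_family_lower_bound (C : {set {set T}}) (m mu : R)
    (D : sensing_procedure R T) (Shat : estimator R T) :
  (expected_precision D <= m%:E)%E ->
  (max_error D Shat mu C <= (1 / 4)%:E)%E ->
  family_lower_bound C m mu.
Proof.
move=> Dm err; exists (fun a => fine (location_precision D a)).
have b0 a : 0 <= fine (location_precision D a).
  by rewrite fine_ge0// location_precision_ge0.
split=> //.
  rewrite -lee_fin -sumEFin; apply: le_trans (Dm).
  apply: le_trans (location_precision_sum D).
  by apply: lee_sum => a _; rewrite fineK// (location_precision_fin_num _ Dm).
move=> I S0 E B B0 I256 EC Einj EB.
pose F i := Shat @^-1` [set (S0 :|: E i)%SET].
have oF i : observation_events (F i) by exact: est_measurable.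
have mF (S : {set T}) i :
    measurable (@observe_signal _ _ D (signal mu S) @^-1` F i).
  apply: measurable_preimage_observation_events (oF i).
  exact: measurable_observe_signal.
pose p i := fine (sp_prob D (observe_signal (signal mu S0) @^-1` F i)).
pose q i := \sum_(a in E i) fine (location_precision D a).
have I0 : (0 < #|I|)%N by exact: leq_trans I256.
have p0 i : 0 <= p i by rewrite fine_ge0.
have q0 i : 0 <= q i by rewrite sumr_ge0.
have pE i : sp_prob D (observe_signal (signal mu S0) @^-1` F i) = (p i)%:E.
  by rewrite fineK// fin_num_measure.
have p1 : \sum_i p i <= 1.
  rewrite -lee_fin -sumEFin; under eq_bigr do rewrite -pE.
  apply: sum_prob_trivIset_le1 => //.
  apply/trivIsetP => i j _ _ ij; apply/seteqP; split => w //= [].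
  by rewrite /F/= => -> /Einj eij; move: ij; rewrite eij eqxx.
have [i [pi qi]] := exists_le_averages I0 B0 p0 q0 p1 EB.
have M256 : 256 <= #|I|%:R :> R by rewrite (ler_nat R 256).
have tau0 : 0 < ln #|I|%:R / 2 :> R.
  by rewrite divr_gt0// ln_gt0//; apply: lt_le_trans M256; rewrite ltr1n.
have := @change_of_measure _ _ D (signal mu (S0 :|: E i)%SET) (signal mu S0) m _
  Dm tau0 _ (oF i).
set V := \sum_a _ => H.
have VB : V <= (2 * (mu ^+ 2 * B)) / #|I|%:R.
  apply: le_trans (signal_sqr_diff_le mu S0 (E i) b0) _.
  rewrite (_ : _ / _ = mu ^+ 2 * (2 * B / #|I|%:R)); last by ring.
  by rewrite ler_wpM2l// sqr_ge0.
(* The numerical lemma is used with w = 2 mu^2 B, the factor 2 being the one lost by averaging two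
   quantities at once. *)
rewrite -[leRHS](_ : 2 * (mu ^+ 2 * B) / 2 = _); last by field.
apply: (two_point_numeric M256 pi VB).
rewrite -lee_fin EFinD (EFinM (expR _) (p i)) -pE; apply: le_trans H.
rewrite -[leRHS](_ : (1 - sp_prob D
    (~` (@observe_signal _ _ D (signal mu (S0 :|: E i)%SET) @^-1` F i)) = _)%E);
  last by rewrite -probability_setC ?setCK//; exact: measurableC.
have errS : (sp_prob D
    (~` (@observe_signal _ _ D (signal mu (S0 :|: E i)%SET) @^-1` F i))
    <= (1 / 4)%:E)%E.
  apply: le_trans err; apply: le_trans (le_bigmax_cond _ _ (EC i)).
  rewrite /error_prob le_eqVlt; apply/orP; left; apply/eqP.
  by congr (sp_prob D _); apply/seteqP; split => w /=; move/eqP.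
rewrite (_ : 3 / 4 = 1 - 1 / 4); last by field.
by rewrite EFinB leeB.
Qed.

End recovery.

Lemma asymptotically_recoverable_family_lower_bound (R : realType)
    (T : nat -> finType) (C : forall t, {set {set T t}}) (m mu : nat -> R) :
  asymptotically_recoverable C m mu ->
  \forall t \near \oo, family_lower_bound (C t) (m t) (mu t).
Proof.
move=> [D [Shat [Dm err]]].
have /fine_cvgP[efin /cvgrPdist_le ecvg] := err.
near=> t; apply: (@recovery_family_lower_bound _ _ _ _ _ (D t) (Shat t)) => //.
have tfin : max_error (D t) (Shat t) (mu t) (C t) \is a fin_num by near: t.
have : `|0 - fine (max_error (D t) (Shat t) (mu t) (C t))| <= 1 / 4.
  by near: t; apply: ecvg.
rewrite sub0r normrN => /(le_trans (ler_norm _)).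
by rewrite -lee_fin fineK.
Unshelve. all: by end_near. Qed.

(** * The classes *)

Section combinatorics.
(* classical_sets shadows names and notations of finset. *)
Import mathcomp.boot.fintype mathcomp.boot.finset.
Local Close Scope classical_set_scope.
Local Open Scope set_scope.

Lemma subset_of_card (T : finType) (Z : {set T}) (s : nat) :
  (s <= #|Z|)%N -> exists2 X : {set T}, X \subset Z & #|X| = s.
Proof.
move=> sZ; exists [set x in take s (enum Z)]%SET.
  by apply/subsetP => x; rewrite inE => /mem_take; rewrite mem_enum.
rewrite cardsE; have /card_uniqP -> : uniq (take s (enum Z)).
  by rewrite take_uniq// enum_uniq.
by rewrite size_take_min -cardE; apply/minn_idPl.
Qed.

Lemma disjoint_unions1 (T : finType) (B : {set {set T}}) :
  disjoint_unions 1 B \subset B.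
Proof.
apply/subsetP => S; rewrite inE => /existsP[D /and4P[DB /cards1P[X DX] _ /eqP ->]].
by rewrite DX /cover big_set1; apply: (subsetP DB); rewrite DX inE.
Qed.

Lemma disjoint_unions_bigcup (T : finType) (k : nat) (B : {set {set T}})
    (F : 'I_k -> {set T}) :
  (forall l, F l \in B) -> (forall l, F l != set0) ->
  (forall l l', l != l' -> [disjoint F l & F l']) ->
  (\bigcup_l F l)%SET \in disjoint_unions k B.
Proof.
move=> FB F0 Fdisj; rewrite inE; apply/existsP; exists (F @: setT)%SET.
have Finj : injective F.
  move=> l l' ll'; apply/eqP/negPn/negP => /Fdisj.
  by rewrite ll' -setI_eq0 setIid (negbTE (F0 l')).
apply/and4P; split.
- by apply/subsetP => _ /imsetP[l _ ->].
- by rewrite card_imset// cardsT card_ord.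
- apply/trivIsetP => _ _ /imsetP[l _ ->] /imsetP[l' _ ->] ll'.
  by apply: Fdisj; apply: contraNneq ll' => ->.
- rewrite cover_imset; apply/eqP; apply: eq_bigl => l; by rewrite inE.
Qed.

(** Cut off [s] elements at a time. For stars this turns any [k * s] edges at one vertex into a
    member of the class. *)
Lemma disjoint_unions_chunks (T : finType) (k s : nat) (B : {set {set T}})
    (S : {set T}) : (0 < s)%N -> #|S| = (k * s)%N ->
  (forall X : {set T}, X \subset S -> #|X| = s -> X \in B) ->
  S \in disjoint_unions k B.
Proof.
move=> s0; elim: k S => [|k IH] S Sk SB.
  have -> : S = set0 by apply/eqP; rewrite -cards_eq0 Sk.
  rewrite inE; apply/existsP; exists set0; apply/and4P; split.
  - exact: sub0set.
  - by rewrite cards0.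
  - by apply/trivIsetP => X Y; rewrite inE.
  - by rewrite /cover big_set0.
have sS : (s <= #|S|)%N by rewrite Sk mulSn leq_addr.
have [X XS Xs] := subset_of_card sS.
have : (S :\: X)%SET \in disjoint_unions k B.
  apply: IH => [|Y YS Ys]; last by apply: SB => //; apply: subset_trans YS (subsetDl _ _).
  by rewrite cardsD (setIidPr XS) Sk Xs mulSn addKn.
rewrite inE => /existsP[D /and4P[DB /eqP Dk Dtriv /eqP SD]].
have X0 : X != set0 by rewrite -card_gt0 Xs.
have XD (Y : {set T}) : Y \in D -> [disjoint X & Y].
  move=> YD; rewrite disjoint_sym disjoints_subset.
  apply: subset_trans (_ : cover D \subset _); first exact: bigcup_sup YD.
  by rewrite -SD setDE; exact: subsetIr.
rewrite inE; apply/existsP; exists (X |: D)%SET; apply/and4P; split.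
- by rewrite subUset sub1set DB andbT; exact: SB.
- rewrite cardsU1 Dk; suff -> : X \notin D by [].
  apply/negP => /XD; rewrite -setI_eq0 setIid; exact/negP.
- apply/trivIsetP => Y Z; rewrite !inE => /orP[/eqP ->|YD] /orP[/eqP ->|ZD].
  + by rewrite eqxx.
  + by move=> _; exact: XD.
  + by move=> _; rewrite disjoint_sym; exact: XD.
  + exact: (trivIsetP Dtriv).
- rewrite /cover bigcup_setU big_set1 -/(cover D) -SD.
  by rewrite setDE setUIr setUCr setIT (setUidPr XS).
Qed.

(** Pieces of a tiling by consecutive intervals; they serve as supports for the interval classes and
    as groups of rows for submatrices. *)
Definition block n (s l : nat) : {set 'I_n} :=
  [set j : 'I_n | (l * s <= j < l * s + s)%N]%SET.

Lemma block_disjoint n s l l' : l != l' -> [disjoint block n s l & block n s l'].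
Proof.
move=> ll'; rewrite -setI_eq0; apply/eqP/setP => j; rewrite !inE.
apply/negP => /andP[/andP[a b] /andP[c d]].
move: ll'; rewrite neq_ltn => /orP[] h.
  have : (l.+1 * s <= l' * s)%N by rewrite leq_mul2r h orbT.
  by rewrite mulSn; lia.
have : (l'.+1 * s <= l * s)%N by rewrite leq_mul2r h orbT.
by rewrite mulSn; lia.
Qed.

Lemma block_index n s l (h : (l * s + s <= n)%N) : (0 < s)%N ->
  (l * s < n)%N.
Proof. lia. Qed.

Lemma block_neq0 n s l : (0 < s)%N -> (l * s + s <= n)%N ->
  block n s l != set0.
Proof.
move=> s0 h; apply/set0Pn; exists (Ordinal (block_index h s0)).
by rewrite inE /=; lia.
Qed.

Lemma block_s_intervals n s l : (0 < s)%N -> (l * s + s <= n)%N ->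
  block n s l \in s_intervals n s.
Proof.
move=> s0 h; rewrite inE; apply/existsP; exists (Ordinal (block_index h s0)).
by rewrite /= h eqxx.
Qed.

Lemma card_block n s l : (l * s + s <= n)%N -> #|block n s l| = s.
Proof.
move=> h; have hr (r : 'I_s) : (l * s + r < n)%N by have := ltn_ord r; lia.
rewrite (_ : block n s l = [set Ordinal (hr r) | r in setT]%SET).
  rewrite card_imset ?cardsT ?card_ord// => r r' [] /addnI; exact: val_inj.
apply/setP => j; rewrite inE; apply/idP/imsetP => [/andP[a b]|[r _ ->]].
  have jr : (j - l * s < s)%N by lia.
  by exists (Ordinal jr) => //; apply: val_inj => /=; lia.
by have := ltn_ord r; rewrite /=; lia.
Qed.

End combinatorics.

(** * Adapted disjoint families and the resulting bound for each class *)

Section classes.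
Import mathcomp.boot.fintype mathcomp.boot.finset.
Local Close Scope classical_set_scope.
Local Open Scope set_scope.
Context (R : realType).

(** One factor 2 is lost in X <= 2 M and another in ln X <= 2 ln M, which holds because M^2 >= X^2 /
    4 >= X. *)
Lemma mul_ln_half (M X : R) : 512 <= X -> X / 2 <= M ->
  X * ln X / 128 <= M * ln M / 32.
Proof.
move=> X512 XM; have X0 : 0 < X by lra.
have M0 : 0 < M by lra.
have lnX : 0 <= ln X by rewrite ln_ge0//; lra.
have lnXM : ln X <= 2 * ln M.
  rewrite mulrC mulr_natr -lnXn// ler_ln ?posrE ?exprn_gt0//.
  have : (X / 2) ^+ 2 <= M ^+ 2 by rewrite lerXn2r// ?nnegrE; lra.
  by rewrite !expr2; nra.
by nra.
Qed.

(** [X] is the ideal number of candidates, possibly not an integer; half of it suffices, and 512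
    ensures that at least 256 are present. As the [E i] are disjoint subsets of [Z], their total
    weight is at most that of [Z]. *)
Definition disjoint_families_bounded (T : finType) (C : {set {set T}})
    (mu : R) (b : T -> R) : Prop :=
  forall (I : finType) (S0 Z : {set T}) (E : I -> {set T}) (B X : R),
    0 < B -> 512 <= X -> X / 2 <= #|I|%:R -> (forall i, S0 :|: E i \in C) ->
    (forall i, E i != set0) -> (forall i, [disjoint S0 & E i]) ->
    (forall i j, i != j -> [disjoint E i & E j]) ->
    (forall i, E i \subset Z) -> \sum_(a in Z) b a <= B ->
    X * ln X / 128 <= mu ^+ 2 * B.

Definition disjoint_family_lower_bound (T : finType) (C : {set {set T}})
    (m mu : R) : Prop :=
  exists b : T -> R,
    [/\ forall a, 0 <= b a, \sum_a b a <= m & disjoint_families_bounded C mu b].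

Lemma family_lower_bound_disjoint (T : finType) (C : {set {set T}}) (m mu : R) :
  family_lower_bound C m mu -> disjoint_family_lower_bound C m mu.
Proof.
move=> [b [b0 bm H]]; exists b; split=> // I S0 Z E B X B0 X512 XI EC E0 SE Edisj EZ ZB.
apply: le_trans (mul_ln_half X512 XI) _.
apply: (H I S0 E B) => //.
- by rewrite -(ler_nat R); lra.
- move=> i j /= ij; apply/eqP/negPn/negP => /Edisj.
  have : E i = E j.
    apply/setP => a; have := congr1 (fun S : {set T} => a \in S) ij.
    rewrite /= !inE; case: (boolP (a \in S0)) => //= aS _.
    have := disjointFr (SE i) aS; have := disjointFr (SE j) aS.
    by move=> -> ->.
  by move=> ->; rewrite -setI_eq0 setIid (negbTE (E0 j)).
- apply: le_trans ZB; rewrite -partition_disjoint_bigcup//.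
  rewrite [leLHS]big_mkcond [leRHS]big_mkcond; apply: ler_sum => a _.
  case: ifPn => [/bigcupP[i _ aE]|_]; last by case: ifP.
  by rewrite (subsetP (EZ i)).
Qed.

Lemma disjoint_family_lower_bound_sub (T : finType) (C C' : {set {set T}})
    (m mu : R) : C' \subset C ->
  disjoint_family_lower_bound C m mu -> disjoint_family_lower_bound C' m mu.
Proof.
move=> CC' [b [b0 bm H]]; exists b; split=> // I S0 Z E B X B0 X512 XI EC.
by apply: H => // i; exact: (subsetP CC').
Qed.

(** Shared by s-sets, with [Z] the whole space, and by stars, with [Z] the edges at one vertex. *)
Lemma one_element_family (T : finType) (C : {set {set T}}) (mu : R)
    (b : T -> R) (S0 Z : {set T}) (B X : R) :
  disjoint_families_bounded C mu b ->
  0 < B -> 512 <= X -> X / 2 <= (#|Z| - #|S0|)%:R -> S0 \subset Z ->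
  (forall a, a \in Z :\: S0 -> a |: S0 \in C) ->
  \sum_(a in Z) b a <= B ->
  X * ln X / 128 <= mu ^+ 2 * B.
Proof.
move=> H B0 X512 XZ S0Z ZC ZB.
apply: (H {a : T | a \in Z :\: S0} S0 Z (fun i => [set val i])) => //.
- by rewrite card_sig cardsD (setIidPr S0Z).
- by move=> i; rewrite setUC; apply: ZC; exact: valP.
- by move=> i; apply/set0Pn; exists (val i); rewrite inE.
- by move=> i; rewrite disjoint_sym disjoints1; have := valP i; rewrite inE => /andP[].
- move=> i j ij; rewrite disjoints1 inE; apply: contra ij => /eqP ij.
  by apply/eqP/val_inj.
- by move=> i; rewrite sub1set; have := valP i; rewrite inE => /andP[].
Qed.

(** A set of s - 1 coordinates is completed by any other one, and [2 * s <= n] leaves at least n/2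
    choices; hence the logarithm of n itself. *)
Lemma s_sets_lower_bound (n s : nat) (m mu : R) :
  (512 <= n)%N -> (0 < s)%N -> (2 * s <= n)%N -> 0 < m ->
  disjoint_family_lower_bound (s_sets n s) m mu ->
  n%:R * ln n%:R / 128 <= mu ^+ 2 * m.
Proof.
move=> n512 s0 sn m0 [b [b0 bm H]].
have sn' : (s.-1 <= #|[set: 'I_n]|)%N by rewrite cardsT card_ord; lia.
have [S0 _ S0s] := subset_of_card sn'.
apply: (one_element_family H (S0 := S0) (Z := setT)) => //.
- by rewrite (ler_nat R 512).
- by rewrite cardsT card_ord S0s ler_pdivrMr// -natrM ler_nat; lia.
- move=> a; rewrite !inE andbT => aS; rewrite cardsU1 aS S0s; apply/eqP; lia.
- by rewrite (eq_bigl xpredT) => [|a]; rewrite ?inE.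
Qed.

(** The first k - 1 blocks of the tiling form [S0] and each later block completes it. Of the N = n
    %/ s blocks, N - (k - 1) remain, and n/s < N + 1 is at most twice that number. *)
Lemma disjoint_intervals_lower_bound (n s k : nat) (m mu : R) :
  (0 < s)%N -> (0 < k)%N -> (512 * (k * s) <= n)%N -> 0 < m ->
  disjoint_family_lower_bound (disjoint_unions k (s_intervals n s)) m mu ->
  n%:R / s%:R * ln (n%:R / s%:R) / 128 <= mu ^+ 2 * m.
Proof.
move=> s0 k0 ksn m0 [b [b0 bm H]].
have sR : 0 < s%:R :> R by rewrite ltr0n.
have [N [Ks kns]] : exists N, (N * s <= n < N * s + s)%N /\ (512 * k <= N)%N.
  exists (n %/ s)%N; split; last by rewrite leq_divRL// -mulnA.
  by rewrite leq_trunc_div /= [X in (X < _)%N](divn_eq n s) ltn_add2l ltn_mod.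
have [K KE] : exists K, K = (N - k.-1)%N by eexists.
have blockn l : (l < N)%N -> (l * s + s <= n)%N.
  move=> h; have : (l.+1 * s <= N * s)%N by rewrite leq_mul2r h orbT.
  by rewrite mulSn; lia.
apply: (H 'I_K (\bigcup_(l < k.-1) block n s l) setT
  (fun i : 'I_K => block n s (k.-1 + i))) => //.
- rewrite ler_pdivlMr// -natrM ler_nat; apply: leq_trans ksn.
  by rewrite leq_mul2l leq_pmull.
- rewrite card_ord ler_pdivrMr// ler_pdivrMr// -!natrM ler_nat.
  have : (n < (N).+1 * s)%N by rewrite mulSn addnC; case/andP: Ks.
  move=> /ltnW/leq_trans; apply; rewrite leq_mul2r; apply/orP; right.
  by lia.
- move=> i; have ik := ltn_ord i.
  (* Enumerates the k blocks of the completed support: those of [S0], then the added one. *)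
  pose f (l : 'I_k) := if (l < k.-1)%N then nat_of_ord l else (k.-1 + i)%N.
  have fn l : (f l < N)%N.
    by rewrite /f; case: ifP => _; have := ltn_ord l; lia.
  have finj l l' : l != l' -> f l != f l'.
    apply: contra => /eqP; rewrite /f => fll'; apply/eqP/val_inj => /=.
    have := ltn_ord l; have := ltn_ord l'.
    by move: fll'; case: ifPn; case: ifPn; lia.
  rewrite (_ : _ :|: _ = \bigcup_l block n s (f l)).
    apply: disjoint_unions_bigcup => [l|l|l l' ll'].
    + exact/block_s_intervals/blockn.
    + exact/block_neq0/blockn.
    + exact/block_disjoint/finj.
  apply/setP => a; rewrite inE; apply/orP/bigcupP => [[/bigcupP[l _ al]|ai]|[l _]].
  + have lk : (l < k)%N by have := ltn_ord l; lia.
    by exists (Ordinal lk) => //; rewrite /f /= ltn_ord.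
  + have lk : (k.-1 < k)%N by lia.
    by exists (Ordinal lk) => //; rewrite /f /= ltnn.
  + rewrite /f; case: ifPn => [lk al|_]; last by right.
    by left; apply/bigcupP; exists (Ordinal lk).
- move=> i; apply: block_neq0 => //; apply: blockn.
  by have := ltn_ord i; lia.
- move=> i; rewrite -setI_eq0; apply/eqP/setP => a; rewrite !inE.
  apply/negP => /andP[/bigcupP[l _ al] ai].
  have li : nat_of_ord l != (k.-1 + i)%N by have := ltn_ord l; lia.
  have := disjointFr (block_disjoint n s li) al.
  by rewrite inE ai.
- by move=> i j ij; apply: block_disjoint; rewrite eqn_add2l.
- by rewrite (eq_bigl xpredT) => [|a]; rewrite ?inE.
Qed.

Definition star (p : nat) (v : 'I_p) : {set edge p} :=
  [set e : edge p | v \in val e].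

Lemma card_star (p : nat) (v : 'I_p) : (p.-1 <= #|star v|)%N.
Proof.
have vu (u : {u : 'I_p | u != v}) : #|[set v; val u]| == 2%N.
  by rewrite cards2; have := valP u; rewrite /= eq_sym => ->.
pose g u : edge p := Sub [set v; val u] (vu u).
have ginj : injective g.
  move=> u u' /(congr1 val) /= guu'; apply: val_inj.
  have : val u \in [set v; val u'] by rewrite -guu' !inE eqxx orbT.
  by rewrite !inE (negbTE (valP u)) => /eqP.
apply: leq_trans (_ : #|g @: setT| <= _)%N.
  by rewrite card_imset// cardsT card_sig cardC1 card_ord.
apply: subset_leq_card; apply/subsetP => _ /imsetP[u _ ->].
by rewrite !inE eqxx.
Qed.

(** Double counting: every edge lies in the stars of its two endpoints. *)
Lemma sum_star (p : nat) (b : edge p -> R) :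
  \sum_v \sum_(e in star v) b e = 2 * \sum_e b e.
Proof.
under eq_bigr do rewrite big_mkcond.
rewrite exchange_big mulr_sumr; apply: eq_bigr => e _ /=.
rewrite -big_mkcond/= (eq_bigl (mem (val e))) => [|v]; last by rewrite inE.
by rewrite sumr_const (eqP (valP e)) mulr_natl.
Qed.

(** Some vertex has edges of total weight at most 2m/p. Inside its star, [k * s - 1] edges are fixed
    and one is added; at least p - ks >= p/2 edges are available. Working inside one star reduces
    the budget from m to 2m/p, which makes up for having only about p candidates. *)
Lemma disjoint_stars_lower_bound (p s k : nat) (m mu : R) :
  (0 < s)%N -> (0 < k)%N -> (512 <= p)%N -> (2 * (k * s) <= p)%N -> 0 < m ->
  disjoint_family_lower_bound (disjoint_unions k (s_stars p s)) m mu ->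
  p%:R * ln p%:R / 128 <= mu ^+ 2 * (2 * m / p%:R).
Proof.
move=> s0 k0 p512 ksp m0 [b [b0 bm H]].
have ks0 : (0 < k * s)%N by rewrite muln_gt0 k0.
have p0 : (0 < #|'I_p|)%N by rewrite card_ord; lia.
have pR : 0 < p%:R :> R by rewrite ltr0n; lia.
have bm2 : \sum_v \sum_(e in star v) b e <= 2 * m by rewrite sum_star ler_pM2l.
have [v] := exists_le_average p0 bm2; rewrite card_ord => bv.
have pv := card_star v.
have [S0 S0v S0s] : exists2 S0 : {set edge p}, S0 \subset star v & #|S0| = (k * s).-1.
  by apply: subset_of_card; lia.
apply: (one_element_family H (S0 := S0) (Z := star v)) => //.
- by rewrite divr_gt0// mulr_gt0.
- by rewrite (ler_nat R 512).
- by rewrite S0s ler_pdivrMr// -natrM ler_nat; lia.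
- move=> a; rewrite inE => /andP[aS av]; apply: (disjoint_unions_chunks s0) => [|X XS Xs].
    by rewrite cardsU1 aS S0s add1n prednK.
  rewrite inE Xs eqxx; apply/existsP; exists v.
  apply/forallP => e; apply/implyP => /(subsetP XS); rewrite !inE.
  by case/orP => [/eqP ->|/(subsetP S0v)]; [move: av|]; rewrite inE.
Qed.

(** Among N = q %/ r disjoint groups of r rows, one has weight at most m/N <= 2mr/q. With these rows
    and r - 1 columns fixed, each remaining column, restricted to these rows, is a candidate [E]. *)
Lemma submatrices_lower_bound (q r : nat) (m mu : R) :
  (0 < r)%N -> (512 <= q)%N -> (2 * r <= q)%N -> 0 < m ->
  disjoint_family_lower_bound (submatrices q q r r) m mu ->
  q%:R * ln q%:R / 128 <= mu ^+ 2 * (2 * m * r%:R / q%:R).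
Proof.
move=> r0 q512 rq m0 [b [b0 bm H]].
have qR : 0 < q%:R :> R by rewrite ltr0n; lia.
have rR : 0 < r%:R :> R by rewrite ltr0n.
have [N [Nr Nq N0]] : exists N, [/\ (N * r <= q)%N, (q <= 2 * (N * r))%N & (0 < N)%N].
  exists (q %/ r)%N; split; first exact: leq_trunc_div.
    have := ltn_pmod q r0; have := divn_eq q r.
    by move: (q %/ r * r)%N (q %% r)%N => x y; lia.
  by rewrite divn_gt0//; lia.
have blockq l : (l < N)%N -> (l * r + r <= q)%N.
  move=> h; have : (l.+1 * r <= N * r)%N by rewrite leq_mul2r h orbT.
  by rewrite mulSn; lia.
have NR : 0 < N%:R :> R by rewrite ltr0n.
pose rows (l : 'I_N) := setX (block q r l) [set: 'I_q].
have rows_le : \sum_l \sum_(a in rows l) b a <= m.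
  rewrite -partition_disjoint_bigcup => [|l l' ll'].
    apply: le_trans bm; rewrite big_mkcond; apply: ler_sum => a _.
    by case: ifP.
  rewrite -setI_eq0; apply/eqP/setP => -[x y].
  rewrite in_setI !in_setX !in_setT !andbT in_set0; apply/negP => /andP[xl].
  by rewrite (disjointFr (@block_disjoint q r l l' ll') xl).
have N0' : (0 < #|'I_N|)%N by rewrite card_ord.
have [l] := exists_le_average N0' rows_le; rewrite card_ord => bl.
set S1 := block q r l in bl.
have S1r : #|S1| = r by apply: card_block; exact: blockq.
have rq' : (r.-1 <= #|[set: 'I_q]|)%N by rewrite cardsT card_ord; lia.
have [S2 _ S2r] := subset_of_card rq'.
apply: (H {j : 'I_q | j \notin S2} (setX S1 S2) (setX S1 setT)
  (fun j => setX S1 [set val j])) => //.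
- by rewrite divr_gt0// !mulr_gt0.
- by rewrite (ler_nat R 512).
- rewrite card_sig ler_pdivrMr// -natrM ler_nat.
  have := cardC (mem S2); rewrite card_ord S2r.
  rewrite (eq_card (B := [pred j | j \notin S2])) => [|j]; last by rewrite !inE.
  by lia.
- move=> j; rewrite inE; apply/existsP; exists S1; apply/existsP.
  exists (val j |: S2); apply/and3P; split.
  + by rewrite S1r.
  + by rewrite cardsU1 (valP j) S2r; lia.
  apply/eqP/setP => -[x y]; rewrite in_setU !in_setX in_set1 in_setU1.
  by case: (x \in S1) => //=; rewrite orbC.
- move=> j; rewrite -card_gt0 cardsX S1r cards1 muln1//.
- move=> j; rewrite -setI_eq0; apply/eqP/setP => -[x y]; rewrite !inE.
  apply/negP => /andP[/andP[_ yS] /andP[_ /eqP yj]].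
  by move: (valP j); rewrite -yj yS.
- move=> i j ij; rewrite -setI_eq0; apply/eqP/setP => -[x y]; rewrite !inE.
  apply/negP => /andP[/andP[_ /eqP yi] /andP[_ /eqP yj]].
  by move: ij; rewrite -(inj_eq val_inj) -yi -yj eqxx.
- by move=> j; apply/subsetP => -[x y]; rewrite !inE => /andP[->].
- apply: le_trans bl _; rewrite ler_pdivlMr// mulrAC ler_pdivrMr//.
  rewrite (_ : 2 * m * _ * _ = m * (2 * (N * r))%:R).
    by rewrite ler_pM2l// ler_nat.
  by rewrite !natrM; ring.
Qed.

End classes.

(** * From the bounds for the classes to the rates *)

Lemma mul_sqrt_le (R : realType) (c x y : R) : 0 <= c -> 0 <= y ->
  c ^+ 2 * x <= y ^+ 2 -> c * Num.sqrt x <= y.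
Proof.
move=> c0 y0 xy; rewrite -[y]ger0_norm// -sqrtr_sqr -{1}[c]ger0_norm// -sqrtr_sqr.
by rewrite -sqrtrM ?sqr_ge0// ler_wsqrtr.
Qed.

Lemma div256_le_div128 (R : realType) (y : R) : 0 <= y -> y / 256 <= y / 128.
Proof. lra. Qed.

(** The class bounds have denominator 128, and the reduced budgets 2m/p and 2mr/q of stars and
    submatrices raise it to 256; the constant 1/16 is the square root of 1/256. *)
Lemma rate_le (R : realType) (x m v L L' : R) : 0 < m -> 0 <= x ->
  0 <= L -> L' <= L -> x * L / 256 <= v * m ->
  (1 / 16) ^+ 2 * (x / (2 * m) * L') <= v.
Proof.
move=> m0 x0 L0 LL' H.
apply: (@le_trans _ _ ((1 / 16) ^+ 2 * (x / (2 * m) * L))).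
  by rewrite ler_wpM2l ?sqr_ge0// ler_wpM2l// divr_ge0// mulr_ge0// ltW.
rewrite [leLHS](_ : _ = x * L / 256 / 2 / m); last by field; exact: lt0r_neq0.
rewrite ler_pdivrMr//; apply: le_trans H.
by have : 0 <= x * L; [exact: mulr_ge0 | lra].
Qed.

Lemma eqo_nat_le (R : realType) (f : nat -> nat) (g : nat -> R) (e : R) :
  (fun t => (f t)%:R : R^o) =o_\oo (fun t => g t : R^o) -> 0 < e ->
  (forall t, 0 <= g t) -> \forall t \near \oo, (f t)%:R <= e * g t.
Proof.
move=> /eqoP fg e0 g0; near=> t.
have : `|(f t)%:R : R^o| <= e * `|g t : R^o| by near: t; exact: fg.
by rewrite !ger0_norm.
Unshelve. all: by end_near. Qed.

Lemma asymptotically_recoverable_disjoint_family (R : realType)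
    (T : nat -> finType) (C : forall t, {set {set T t}}) (m mu : nat -> R) :
  asymptotically_recoverable C m mu ->
  \forall t \near \oo, disjoint_family_lower_bound (C t) (m t) (mu t).
Proof.
move=> /asymptotically_recoverable_family_lower_bound.
by apply: filterS => t; exact: family_lower_bound_disjoint.
Qed.

Unset Implicit Arguments.

Theorem corollary7 (R : realType) :
  exists c : R, 0 < c /\
  forall (n s k : nat -> nat) (m mu : nat -> R),
    (forall t, (0 < n t)%N) -> (forall t, (0 < s t)%N) ->
    (forall t, (0 < k t)%N) -> (forall t, 0 < m t) -> (forall t, 0 < mu t) ->
    n @ \oo --> \oo ->
  [/\
    (* s-sets *)
    (fun t => (s t)%:R : R^o) =o_\oo (fun t => (n t)%:R : R^o) ->
    asymptotically_recoverable (fun t => s_sets (n t) (s t)) m mu ->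
    \forall t \near \oo,
      c * Num.sqrt ((n t)%:R / (2 * m t) * ln ((n t)%:R / (s t)%:R)) <= mu t,

    (* s-intervals *)
    (fun t => (s t)%:R : R^o) =o_\oo (fun t => (n t)%:R : R^o) ->
    asymptotically_recoverable (fun t => s_intervals (n t) (s t)) m mu ->
    \forall t \near \oo,
      c * Num.sqrt ((n t)%:R / (2 * (s t)%:R * m t)
                    * ln ((n t)%:R / (s t)%:R)) <= mu t,

    (* unions of k disjoint s-intervals *)
    (fun t => (k t * s t)%:R : R^o) =o_\oo (fun t => (n t)%:R : R^o) ->
    asymptotically_recoverable
      (fun t => disjoint_unions (k t) (s_intervals (n t) (s t))) m mu ->
    \forall t \near \oo,
      c * Num.sqrt ((n t)%:R / (2 * (s t)%:R * m t)
                    * ln ((n t)%:R / (k t * s t)%:R)) <= mu t,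

    (* unions of k disjoint s-stars, n = p (p - 1) / 2 *)
    (forall p : nat -> nat,
      (forall t, n t = (p t * (p t).-1)./2) ->
      (fun t => (k t * s t)%:R : R^o) =o_\oo
        (fun t => Num.sqrt (n t)%:R : R^o) ->
      asymptotically_recoverable
        (fun t => disjoint_unions (k t) (s_stars (p t) (s t))) m mu ->
      \forall t \near \oo,
        c * Num.sqrt ((n t)%:R / (2 * m t)
              * ln (Num.sqrt (2 * (n t)%:R) / (k t * s t)%:R)) <= mu t)
  & (* submatrices, n1 = n2 = sqrt n = q and s1 = s2 = sqrt s = r *)
    (forall q r : nat -> nat,
      (forall t, n t = (q t ^ 2)%N) -> (forall t, s t = (r t ^ 2)%N) ->
      (fun t => (s t)%:R : R^o) =o_\oo (fun t => (n t)%:R : R^o) ->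
      asymptotically_recoverable
        (fun t => submatrices (q t) (q t) (r t) (r t)) m mu ->
      \forall t \near \oo,
        c * Num.sqrt ((n t)%:R / (4 * Num.sqrt (s t)%:R * m t)
              * ln ((n t)%:R / (s t)%:R)) <= mu t)].
Proof.
exists (1 / 16); split=> [|n s k m mu n0 s0 k0 m0 mu0 noo]; first by rewrite divr_gt0.
have mu1 t : 0 <= mu t := ltW (mu0 t).
have nR t : 0 < (n t)%:R :> R by rewrite ltr0n.
have sR t : 0 < (s t)%:R :> R by rewrite ltr0n.
have c0 : 0 <= 1 / 16 :> R by rewrite divr_ge0.
have n_large N : \forall t \near \oo, (N <= n t)%N by move/cvgnyPge : noo; exact.
have nR0 t : 0 <= (n t)%:R :> R := ltW (nR t).
have intervals (k' : nat -> nat) : (forall t, 0 < k' t)%N ->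
    (fun t => (k' t * s t)%:R : R^o) =o_\oo (fun t => (n t)%:R : R^o) ->
    (\forall t \near \oo, disjoint_family_lower_bound
      (disjoint_unions (k' t) (s_intervals (n t) (s t))) (m t) (mu t)) ->
    \forall t \near \oo,
      1 / 16 * Num.sqrt ((n t)%:R / (2 * (s t)%:R * m t)
                    * ln ((n t)%:R / (k' t * s t)%:R)) <= mu t.
  move=> k'0 ksn rec.
  (* With ks <= n/512, the ratio n/s is at least 512 and the k - 1 blocks of [S0] are a small part
     of the tiling. *)
  have e0 : 0 < 1 / 512 :> R by lra.
  have ksn512 := eqo_nat_le ksn e0 nR0.
  near=> t.
  have ksnt : (512 * (k' t * s t) <= n t)%N.
    have : (k' t * s t)%:R <= 1 / 512 * (n t)%:R :> R.
      by near: t; exact: ksn512.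
    by rewrite -(ler_nat R) natrM; lra.
  have rect : disjoint_family_lower_bound
      (disjoint_unions (k' t) (s_intervals (n t) (s t))) (m t) (mu t).
    by near: t.
  have H := disjoint_intervals_lower_bound (s0 t) (k'0 t) ksnt (m0 t) rect.
  have ns1 : 1 <= (n t)%:R / (s t)%:R :> R.
    rewrite ler_pdivlMr// mul1r ler_nat; apply: leq_trans ksnt.
    by rewrite mulnA leq_pmull// muln_gt0 k'0.
  apply: mul_sqrt_le => //.
  rewrite (_ : _ / (2 * _ * _) = (n t)%:R / (s t)%:R / (2 * m t)); last first.
    by field; rewrite !lt0r_neq0.
  apply: (@rate_le _ _ _ _ (ln ((n t)%:R / (s t)%:R))) => //.
  - exact: ln_ge0.
  - rewrite ler_ln ?posrE ?divr_gt0 ?ltr0n ?muln_gt0 ?s0 ?k'0//.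
    rewrite ler_pM2l// lef_pV2 ?posrE ?ltr0n ?muln_gt0 ?s0 ?k'0//.
    by rewrite ler_nat leq_pmull.
  - by apply: le_trans H; apply: div256_le_div128; rewrite mulr_ge0 ?ln_ge0// divr_ge0.
split.
- move=> sn /asymptotically_recoverable_disjoint_family rec.
  have e0 : 0 < 1 / 2 :> R by rewrite divr_gt0.
  have sn2 := eqo_nat_le sn e0 nR0.
  near=> t.
  have snt : (2 * s t <= n t)%N.
    have : (s t)%:R <= 1 / 2 * (n t)%:R :> R by near: t; exact: sn2.
    by rewrite -(ler_nat R) natrM; lra.
  have rect : disjoint_family_lower_bound (s_sets (n t) (s t)) (m t) (mu t).
    by near: t.
  have n512 : (512 <= n t)%N by near: t; exact: n_large.
  have H := s_sets_lower_bound n512 (s0 t) snt (m0 t) rect.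
  have n1 : 1 <= (n t)%:R :> R by rewrite ler1n.
  apply: mul_sqrt_le => //.
  apply: (@rate_le _ _ _ _ (ln (n t)%:R)) => //.
  - exact: ln_ge0.
  - rewrite ler_ln ?posrE ?divr_gt0//.
    by rewrite ler_pdivrMr// ler_peMr ?ler1n// ltW.
  - by apply: le_trans H; apply: div256_le_div128; rewrite mulr_ge0 ?ln_ge0// divr_ge0.
- move=> sn /asymptotically_recoverable_disjoint_family rec.
  have sE : (fun t => (1 * s t)%:R : R^o) = (fun t => (s t)%:R).
    by apply/funext => t; rewrite mul1n.
  have := intervals (fun=> 1%N) (fun=> isT); rewrite sE => /(_ sn) rate.
  have : \forall t \near \oo, disjoint_family_lower_bound
      (disjoint_unions 1 (s_intervals (n t) (s t))) (m t) (mu t).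
    apply: filterS rec => t; apply: disjoint_family_lower_bound_sub.
    exact: disjoint_unions1.
  by move=> /rate; apply: filterS => t; rewrite mul1n.
- move=> ksn /asymptotically_recoverable_disjoint_family; exact: intervals.
- move=> p np ksn /asymptotically_recoverable_disjoint_family rec.
  have e0 : 0 < 1 / 2 :> R by rewrite divr_gt0.
  have ksn2 := eqo_nat_le ksn e0 (fun t => sqrtr_ge0 _).
  near=> t.
  have n_t : (512 * 512 <= n t)%N by near: t; exact: n_large.
  (* From 2n <= p^2 come sqrt (2n) <= p, which compares the logarithms, p >= 512, and 2ks <= p. *)
  have npt : (2 * n t <= p t * p t)%N.
    have := np t; have : (p t * (p t).-1 <= p t * p t)%N by rewrite leq_mul2l leq_pred orbT.
    have := odd_double_half (p t * (p t).-1); rewrite -mul2n; lia.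
  have npR : 2 * (n t)%:R <= (p t)%:R ^+ 2 :> R.
    by rewrite expr2 -!natrM ler_nat.
  have sqrt_np : Num.sqrt (2 * (n t)%:R) <= (p t)%:R :> R.
    by rewrite -[leRHS]ger0_norm// -sqrtr_sqr ler_wsqrtr.
  have pt : (512 <= p t)%N by nia.
  have ksp : (2 * (k t * s t) <= p t)%N.
    have ks : (k t * s t)%:R <= 1 / 2 * Num.sqrt (n t)%:R :> R by near: t; exact: ksn2.
    have : Num.sqrt (n t)%:R <= (p t)%:R :> R.
      apply: le_trans sqrt_np; apply: ler_wsqrtr; have := nR t; lra.
    by rewrite -(ler_nat R) natrM; lra.
  have rect : disjoint_family_lower_bound
      (disjoint_unions (k t) (s_stars (p t) (s t))) (m t) (mu t) by near: t.
  have H := disjoint_stars_lower_bound (s0 t) (k0 t) pt ksp (m0 t) rect.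
  have pt0 : (0 < p t)%N by exact: leq_trans pt.
  have p0 : 0 < (p t)%:R :> R by rewrite ltr0n.
  have p1 : 1 <= (p t)%:R :> R by rewrite ler1n.
  have ks0 : (0 < k t * s t)%N by rewrite muln_gt0 k0 s0.
  have lnp : 0 <= ln (p t)%:R :> R by exact: ln_ge0.
  apply: mul_sqrt_le => //.
  apply: (@rate_le _ _ _ _ (ln (p t)%:R)) => //.
  - rewrite ler_ln ?posrE ?divr_gt0 ?ltr0n// ?sqrtr_gt0 ?mulr_gt0//.
    rewrite ler_pdivrMr ?ltr0n//; apply: le_trans sqrt_np _.
    by rewrite ler_peMr ?ler1n// ltW.
  - have : (p t)%:R ^+ 2 * ln (p t)%:R / 256 <= mu t ^+ 2 * m t.
      move: H; rewrite mulrA ler_pdivlMr// expr2.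
      rewrite (_ : _ / 128 * _ = (p t)%:R * (p t)%:R * ln (p t)%:R / 128); last by ring.
      lra.
    have : 2 * (n t)%:R * ln (p t)%:R <= (p t)%:R ^+ 2 * ln (p t)%:R :> R.
      exact: (ler_wpM2r lnp npR).
    have : 0 <= (n t)%:R * ln (p t)%:R :> R by rewrite mulr_ge0.
    lra.
- move=> q r nq sr sn /asymptotically_recoverable_disjoint_family rec.
  (* In terms of side lengths, s <= n/4 reads 2r <= q. *)
  have e0 : 0 < 1 / 4 :> R by rewrite divr_gt0.
  have sn4 := eqo_nat_le sn e0 nR0.
  near=> t.
  have n_t : (512 * 512 <= n t)%N by near: t; exact: n_large.
  have qt : (512 <= q t)%N by move: n_t; rewrite nq; nia.
  have rt : (0 < r t)%N by have := s0 t; rewrite sr; case: (r t).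
  have rq : (2 * r t <= q t)%N.
    have : (s t)%:R <= 1 / 4 * (n t)%:R :> R by near: t; exact: sn4.
    have : (4 * s t <= n t)%N -> (2 * r t <= q t)%N by rewrite nq sr; nia.
    move=> h1 h2; apply: h1; rewrite -(ler_nat R) natrM; lra.
  have rect : disjoint_family_lower_bound
      (submatrices (q t) (q t) (r t) (r t)) (m t) (mu t) by near: t.
  have H := submatrices_lower_bound rt qt rq (m0 t) rect.
  have qt0 : (0 < q t)%N by exact: leq_trans qt.
  have q0 : 0 < (q t)%:R :> R by rewrite ltr0n.
  have q1 : 1 <= (q t)%:R :> R by rewrite ler1n.
  have r0 : 0 < (r t)%:R :> R by rewrite ltr0n.
  have lnq : 0 <= ln (q t)%:R :> R by exact: ln_ge0.
  apply: mul_sqrt_le => //.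
  rewrite (_ : Num.sqrt (s t)%:R = (r t)%:R :> R); last first.
    by rewrite sr natrX sqrtr_sqr ger0_norm.
  rewrite (_ : _ / (4 * _ * _) = (n t)%:R / (r t)%:R / (2 * (2 * m t))); last first.
    by field; rewrite !lt0r_neq0.
  (* The 4 of the rate is split as 2 * 2: the budget is taken to be 2m, matched by the logarithm 2
     ln q = ln n, which is at least ln (n/s). *)
  apply: (@rate_le _ _ _ _ (2 * ln (q t)%:R)) => //.
  - by rewrite mulr_gt0.
  - by rewrite mulr_ge0.
  - rewrite [leRHS]mulrC mulr_natr -lnXn// -natrX -nq ler_ln ?posrE ?divr_gt0//.
    by rewrite ler_pdivrMr// ler_peMr ?ler1n// ltW.
  - have H' : (q t)%:R ^+ 2 / (r t)%:R * ln (q t)%:R / 256 <= mu t ^+ 2 * m t.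
      rewrite mulrAC -[leLHS]mulrA mulrAC ler_pdivrMr//.
      move: H; rewrite mulrA ler_pdivlMr// expr2; lra.
    have : 0 <= mu t ^+ 2 * m t by rewrite mulr_ge0 ?sqr_ge0// ltW.
    rewrite nq natrX; lra.
Unshelve. all: by end_near. Qed.
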